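(* Let $(S,\mathfrak n)$ be a commutative noetherian local ring and let $\omega\in\mathfrak n$ be a non-zerodivisor. Then there is a triangle equivalence functor $F':\underline{\mathsf{Mon}}(\omega,\mathcal P)\longrightarrow\underline{\mathsf{MF}}(\omega,\mathcal P)$.
   Context: All modules are finitely generated; $\mathcal P(S)$ is the category of finitely generated projective $S$-modules. $\mathsf{Mon}(\omega,\mathcal P)$ is the category whose objects are the injective $S$-homomorphisms $(P_1\xrightarrow{f}P_0)$ with $P_1,P_0\in\mathcal P(S)$ and $\omega\,\mathrm{Coker} f=0$; morphisms $(P_1\xrightarrow{f}P_0)\to(P'_1\xrightarrow{f'}P'_0)$ are pairs $(\varphi_1,\varphi_0)$ of $S$-homomorphisms $\varphi_i:P_i\to P_i'$ with $f'\varphi_1=\varphi_0 f$. $\mathsf{MF}(\omega,\mathcal P)$ is the category of matrix factorizations of $\omega$: objects are ordered pairs of $S$-homomorphisms $(P_1\xrightarrow{\rho_1}P_0,\ P_0\xrightarrow{\rho_0}P_1)$ with $P_1,P_0\in\mathcal P(S)$, $\rho_1\rho_0=\omega\cdot\mathrm{id}_{P_0}$ and $\rho_0\rho_1=\omega\cdot\mathrm{id}_{P_1}$; morphisms $(\rho_1,\rho_0)\to(q_1,q_0)$, where $q_1:Q_1\to Q_0$ and $q_0:Q_0\to Q_1$, are pairs of $S$-homomorphisms $\psi_i:P_i\to Q_i$ with $q_1\psi_1=\psi_0\rho_1$ and $q_0\psi_0=\psi_1\rho_0$. Both are exact categories with the componentwise short exact sequences (with all terms in the category) as conflations, and both are Frobenius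 categories (enough projectives and injectives, which coincide). The stable category $\underline{\mathcal F}$ of a Frobenius category $\mathcal F$ has the same objects, with morphisms taken modulo those factoring through projective objects; it carries Happel's triangulated structure, with shift the inverse syzygy and distinguished triangles induced by conflations. A triangle functor is an additive functor commuting with shifts up to natural isomorphism and preserving distinguished triangles; a triangle equivalence is a triangle functor that is an equivalence. *)

(* Defs.v *)
From HB Require Import structures.
From mathcomp Require Import all_boot all_algebra.
From mathcomp Require Import generic_quotient ring_quotient.
From mathcomp Require Import boolp.

Set Implicit Arguments.
Unset Strict Implicit.
Unset Printing Implicit Defensive.

Import GRing.Theory.
Local Open Scope ring_scope.
Local Open Scope quotient_scope.

Declare Scope cat_scope.
Local Open Scope cat_scope.

(** * Preadditive categories, functors, natural isomorphisms *)

Record preadditive := Preadditive {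
  obj :> Type;
  hom : obj -> obj -> zmodType;
  idm : forall X, hom X X;
  comp : forall X Y Z, hom Y Z -> hom X Y -> hom X Z;
  comp1m : forall X Y (f : hom X Y), comp (idm Y) f = f;
  compm1 : forall X Y (f : hom X Y), comp f (idm X) = f;
  compA : forall W X Y Z (h : hom Y Z) (g : hom X Y) (f : hom W X),
    comp h (comp g f) = comp (comp h g) f;
  compDl : forall X Y Z (g g' : hom Y Z) (f : hom X Y),
    comp (g + g') f = comp g f + comp g' f;
  compDr : forall X Y Z (g : hom Y Z) (f f' : hom X Y),
    comp g (f + f') = comp g f + comp g f' }.

Arguments hom {_}.
Arguments idm {_}.
Arguments comp {_ _ _ _}.
Notation "g ∘ f" := (comp g f)
  (at level 40, left associativity, format "g  ∘  f") : cat_scope.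

Record functor (C D : preadditive) := Functor {
  fobj :> C -> D;
  fmap : forall X Y : C, hom X Y -> hom (fobj X) (fobj Y);
  fmap1 : forall X : C, fmap (idm X) = idm (fobj X);
  fmapM : forall (X Y Z : C) (g : hom Y Z) (f : hom X Y),
    fmap (g ∘ f) = fmap g ∘ fmap f }.

Arguments fmap {_ _} _ {_ _}.

Definition id_functor (C : preadditive) : functor C C :=
  @Functor C C id (fun _ _ f => f) (fun=> erefl) (fun _ _ _ _ _ => erefl).

Lemma fcomp1 (C D E : preadditive) (G : functor D E) (F : functor C D) (X : C) :
  fmap G (fmap F (idm X)) = idm (G (F X)).
Proof. by rewrite !fmap1. Qed.

Lemma fcompM (C D E : preadditive) (G : functor D E) (F : functor C D)
    (X Y Z : C) (g : hom Y Z) (f : hom X Y) :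
  fmap G (fmap F (g ∘ f)) = fmap G (fmap F g) ∘ fmap G (fmap F f).
Proof. by rewrite !fmapM. Qed.

Definition comp_functor (C D E : preadditive)
    (G : functor D E) (F : functor C D) : functor C E :=
  @Functor C E (fun X => G (F X)) (fun _ _ f => fmap G (fmap F f))
    (@fcomp1 C D E G F) (@fcompM C D E G F).

Definition additive_functor (C D : preadditive) (F : functor C D) :=
  forall (X Y : C) (f g : hom X Y), fmap F (f + g) = fmap F f + fmap F g.

Definition is_iso (C : preadditive) (X Y : C) (f : hom X Y) :=
  exists g : hom Y X, g ∘ f = idm X /\ f ∘ g = idm Y.

Definition natural_iso (C D : preadditive) (F G : functor C D)
    (phi : forall X : C, hom (F X) (G X)) :=
  (forall X, is_iso (phi X)) /\
  (forall (X Y : C) (f : hom X Y), fmap G f ∘ phi X = phi Y ∘ fmap F f).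

Definition naturally_isomorphic (C D : preadditive) (F G : functor C D) :=
  exists phi, @natural_iso C D F G phi.

Definition is_equivalence (C D : preadditive) (F : functor C D) :=
  exists G : functor D C,
    naturally_isomorphic (comp_functor G F) (id_functor C) /\
    naturally_isomorphic (comp_functor F G) (id_functor D).

(** * Exact categories and Frobenius categories *)

Definition additive_category (C : preadditive) :=
  (exists O : C, idm O = 0) /\
  (forall X Y : C, exists (B : C) (i1 : hom X B) (i2 : hom Y B)
                          (p1 : hom B X) (p2 : hom B Y),
    [/\ p1 ∘ i1 = idm X, p2 ∘ i2 = idm Y, p1 ∘ i2 = 0, p2 ∘ i1 = 0
      & i1 ∘ p1 + i2 ∘ p2 = idm B]).

Definition kernel_of (C : preadditive) (X Y Z : C)
    (i : hom X Y) (p : hom Y Z) :=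
  p ∘ i = 0 /\
  forall (T : C) (t : hom T Y), p ∘ t = 0 -> exists! u : hom T X, i ∘ u = t.

Definition cokernel_of (C : preadditive) (X Y Z : C)
    (i : hom X Y) (p : hom Y Z) :=
  p ∘ i = 0 /\
  forall (T : C) (t : hom Y T), t ∘ i = 0 -> exists! u : hom Z T, u ∘ p = t.

Definition pushout (C : preadditive) (X Y X' Y' : C)
    (i : hom X Y) (g : hom X X') (g' : hom Y Y') (i' : hom X' Y') :=
  g' ∘ i = i' ∘ g /\
  forall (T : C) (a : hom Y T) (b : hom X' T), a ∘ i = b ∘ g ->
    exists! c : hom Y' T, c ∘ g' = a /\ c ∘ i' = b.

Definition pullback (C : preadditive) (Y Z Y' Z' : C)
    (p : hom Y Z) (g : hom Z' Z) (g' : hom Y' Y) (p' : hom Y' Z') :=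
  p ∘ g' = g ∘ p' /\
  forall (T : C) (a : hom T Y) (b : hom T Z'), p ∘ a = g ∘ b ->
    exists! c : hom T Y', g' ∘ c = a /\ p' ∘ c = b.

Definition sequence_class (C : preadditive) :=
  forall X Y Z : C, hom X Y -> hom Y Z -> Prop.

Section Exact.
Variables (C : preadditive) (E : sequence_class C).

Definition inflation (X Y : C) (i : hom X Y) :=
  exists (Z : C) (p : hom Y Z), E i p.

Definition deflation (Y Z : C) (p : hom Y Z) :=
  exists (X : C) (i : hom X Y), E i p.

Record exact_structure : Prop := ExactStructure {
  conflation_kernel : forall (X Y Z : C) (i : hom X Y) (p : hom Y Z),
    E i p -> kernel_of i p;
  conflation_cokernel : forall (X Y Z : C) (i : hom X Y) (p : hom Y Z),
    E i p -> cokernel_of i p;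
  conflation_iso : forall (X Y Z X' Y' Z' : C)
      (i : hom X Y) (p : hom Y Z) (i' : hom X' Y') (p' : hom Y' Z')
      (a : hom X X') (b : hom Y Y') (c : hom Z Z'),
    is_iso a -> is_iso b -> is_iso c -> b ∘ i = i' ∘ a -> c ∘ p = p' ∘ b ->
    E i p -> E i' p';
  inflation_id : forall X : C, inflation (idm X);
  deflation_id : forall X : C, deflation (idm X);
  inflation_comp : forall (X Y Z : C) (j : hom Y Z) (i : hom X Y),
    inflation i -> inflation j -> inflation (j ∘ i);
  deflation_comp : forall (X Y Z : C) (q : hom Y Z) (p : hom X Y),
    deflation p -> deflation q -> deflation (q ∘ p);
  inflation_pushout : forall (X Y X' : C) (i : hom X Y) (g : hom X X'),
    inflation i -> exists (Y' : C) (g' : hom Y Y') (i' : hom X' Y'),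
      pushout i g g' i' /\ inflation i';
  deflation_pullback : forall (Y Z Z' : C) (p : hom Y Z) (g : hom Z' Z),
    deflation p -> exists (Y' : C) (g' : hom Y' Y) (p' : hom Y' Z'),
      pullback p g g' p' /\ deflation p' }.

Definition projective_object (P : C) :=
  forall (Y Z : C) (p : hom Y Z) (f : hom P Z), deflation p ->
    exists g : hom P Y, p ∘ g = f.

Definition injective_object (I : C) :=
  forall (X Y : C) (i : hom X Y) (f : hom X I), inflation i ->
    exists g : hom Y I, g ∘ i = f.

Record injective_embedding (X : C) := InjectiveEmbedding {
  inj_mid : C;
  inj_coker : C;
  inj_in : hom X inj_mid;
  inj_out : hom inj_mid inj_coker;
  inj_conflation : E inj_in inj_out;
  inj_injective : injective_object inj_mid }.

Definition enough_injectives := forall X : C, inhabited (injective_embedding X).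

Definition enough_projectives := forall X : C,
  exists (P : C) (p : hom P X), projective_object P /\ deflation p.

End Exact.

Lemma retract_injective (C : preadditive) (E : sequence_class C) (X I : C)
    (i : hom X I) (p : hom I X) :
  p ∘ i = idm X -> injective_object E I -> injective_object E X.
Proof.
move=> pi injI A B j f jE; have [g gE] := injI _ _ j (i ∘ f) jE.
by exists (p ∘ g); rewrite -compA gE compA pi comp1m.
Qed.

Lemma retract_projective (C : preadditive) (E : sequence_class C) (X P : C)
    (i : hom X P) (p : hom P X) :
  p ∘ i = idm X -> projective_object E P -> projective_object E X.
Proof.
move=> pi projP A B q f qE; have [g gE] := projP _ _ q (f ∘ p) qE.
by exists (g ∘ i); rewrite compA gE -compA pi compm1.
Qed.

Record frobenius_category := FrobeniusCategory {
  frob_cat :> preadditive;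
  conflation : sequence_class frob_cat;
  frob_additive : additive_category frob_cat;
  frob_exact : exact_structure conflation;
  frob_enough_inj : enough_injectives conflation;
  frob_enough_proj : enough_projectives conflation;
  frob_proj_inj : forall X : frob_cat,
    projective_object conflation X <-> injective_object conflation X }.

Arguments conflation {_} [X Y Z].

(** * Categories with a shift and a class of distinguished triangles *)

(* The axioms TR1-TR4 are not part of this record: for the stable category of a
   Frobenius category, the only instance below, they are Happel's theorem, and
   the notion of a triangle functor only refers to the data. *)
Record triangle_category := TriangleCategory {
  tri_cat :> preadditive;
  shift : functor tri_cat tri_cat;
  distinguished : forall X Y Z : tri_cat,
    hom X Y -> hom Y Z -> hom Z (shift X) -> Prop }.

Arguments shift {_}.
Arguments distinguished {_} [X Y Z].

Definition triangle_functor (T T' : triangle_category) (F : functor T T') :=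
  additive_functor F /\
  exists phi : forall X : T, hom (F (shift X)) (shift (F X)),
    natural_iso (F := comp_functor F shift) (G := comp_functor shift F) phi /\
    (forall (X Y Z : T) (u : hom X Y) (v : hom Y Z) (w : hom Z (shift X)),
       distinguished u v w ->
       distinguished (fmap F u) (fmap F v) (phi X ∘ fmap F w)).

Definition triangle_equivalence (T T' : triangle_category) (F : functor T T') :=
  triangle_functor F /\ is_equivalence F.

(** * The stable category of a Frobenius category *)

Section PreadditiveTheory.
Variable C : preadditive.
Implicit Types X Y Z : C.

Lemma comp0m X Y Z (f : hom X Y) : (0 : hom Y Z) ∘ f = 0.
Proof. by apply: (addrI (0 ∘ f)); rewrite -compDl !addr0. Qed.

Lemma compm0 X Y Z (g : hom Y Z) : g ∘ (0 : hom X Y) = 0.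
Proof. by apply: (addrI (g ∘ 0)); rewrite -compDr !addr0. Qed.

Lemma compNm X Y Z (g : hom Y Z) (f : hom X Y) : (- g) ∘ f = - (g ∘ f).
Proof. by apply: (addrI (g ∘ f)); rewrite -compDl !subrr comp0m. Qed.

Lemma compmN X Y Z (g : hom Y Z) (f : hom X Y) : g ∘ (- f) = - (g ∘ f).
Proof. by apply: (addrI (g ∘ f)); rewrite -compDr !subrr compm0. Qed.

Lemma compBl X Y Z (g g' : hom Y Z) (f : hom X Y) :
  (g - g') ∘ f = g ∘ f - g' ∘ f.
Proof. by rewrite compDl compNm. Qed.

Lemma compBr X Y Z (g : hom Y Z) (f f' : hom X Y) :
  g ∘ (f - f') = g ∘ f - g ∘ f'.
Proof. by rewrite compDr compmN. Qed.

End PreadditiveTheory.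

Section Stable.
Variable C : frobenius_category.
Implicit Types X Y Z : C.

Definition stably_null X Y (f : hom X Y) :=
  exists (P : C) (a : hom X P) (b : hom P Y),
    projective_object (@conflation C) P /\ f = b ∘ a.

Definition null_maps X Y : {pred hom X Y} := fun f => `[< stably_null f >].

Arguments null_maps : clear implicits.

Lemma null_mapsP X Y (f : hom X Y) : reflect (stably_null f) (f \in null_maps X Y).
Proof. exact: asboolP. Qed.

Lemma null_maps_zmod_closed X Y : zmod_closed (null_maps X Y).
Proof.
split=> [|f g /null_mapsP[P [a [b [Pp ->]]]] /null_mapsP[Q [c [d [Qp ->]]]]].
  apply/null_mapsP; have [P [p [Pp _]]] := frob_enough_proj X.
  by exists P, 0, 0; split; rewrite // compm0.
apply/null_mapsP; have [_ /(_ P Q)] := frob_additive C.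
move=> [B [i1 [i2 [p1 [p2 [e11 e22 e12 e21 e]]]]]].
exists B, (i1 ∘ a + i2 ∘ c), (b ∘ p1 - d ∘ p2); split.
  move=> U V q h dq; have [g1 Hg1] := Pp _ _ q (h ∘ i1) dq.
  have [g2 Hg2] := Qp _ _ q (h ∘ i2) dq.
  exists (g1 ∘ p1 + g2 ∘ p2).
  by rewrite compDr !compA Hg1 Hg2 -!compA -compDr e compm1.
rewrite compBl !compDr !compA -[b ∘ p1 ∘ i1]compA -[b ∘ p1 ∘ i2]compA.
rewrite -[d ∘ p2 ∘ i1]compA -[d ∘ p2 ∘ i2]compA.
by rewrite e11 e22 e12 e21 !compm0 !comp0m !compm1 addr0 add0r.
Qed.

HB.instance Definition _ X Y :=
  GRing.isZmodClosed.Build (hom X Y) (null_maps X Y) (null_maps_zmod_closed X Y).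

Definition shom X Y : zmodType := Quotient.quot (null_maps X Y).

Definition sclass X Y (f : hom X Y) : shom X Y := \pi f.

Definition srepr X Y (f : shom X Y) : hom X Y := repr f.

Lemma sreprK X Y (f : shom X Y) : sclass (srepr f) = f.
Proof. exact: reprK. Qed.

Lemma sclass_eq X Y (f g : hom X Y) : sclass f = sclass g <-> stably_null (f - g).
Proof.
split=> [e|h].
  by apply/null_mapsP; rewrite Quotient.idealrBE; apply/eqP.
by apply/eqP; rewrite -[_ == _]Quotient.idealrBE; apply/null_mapsP.
Qed.

Lemma sclassD X Y (f g : hom X Y) : sclass (f + g) = sclass f + sclass g.
Proof. exact: raddfD. Qed.

Lemma sclassN X Y (f : hom X Y) : sclass (- f) = - sclass f.
Proof. exact: raddfN. Qed.

Definition scomp X Y Z (g : shom Y Z) (f : shom X Y) : shom X Z :=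
  sclass (srepr g ∘ srepr f).

Lemma scompE X Y Z (g : hom Y Z) (f : hom X Y) :
  scomp (sclass g) (sclass f) = sclass (g ∘ f).
Proof.
have /sclass_eq [P [a [b [Pp e]]]] := sreprK (sclass g).
have /sclass_eq [Q [c [d [Qp e']]]] := sreprK (sclass f).
transitivity (sclass (srepr (sclass g) ∘ f)); apply/sclass_eq.
  by rewrite -compBr e'; exists Q, c, (srepr (sclass g) ∘ d); rewrite compA.
by rewrite -compBl e; exists P, (a ∘ f), b; rewrite compA.
Qed.

Lemma sclassP X Y (f : shom X Y) : exists f0, f = sclass f0.
Proof. by exists (srepr f); rewrite sreprK. Qed.

Lemma scomp1m X Y (f : shom X Y) : scomp (sclass (idm Y)) f = f.
Proof. by have [f0 ->] := sclassP f; rewrite scompE comp1m. Qed.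

Lemma scompm1 X Y (f : shom X Y) : scomp f (sclass (idm X)) = f.
Proof. by have [f0 ->] := sclassP f; rewrite scompE compm1. Qed.

Lemma scompA W X Y Z (h : shom Y Z) (g : shom X Y) (f : shom W X) :
  scomp h (scomp g f) = scomp (scomp h g) f.
Proof.
have [[h0 ->] [g0 ->] [f0 ->]] := And3 (sclassP h) (sclassP g) (sclassP f).
by rewrite !scompE compA.
Qed.

Lemma scompDl X Y Z (g g' : shom Y Z) (f : shom X Y) :
  scomp (g + g') f = scomp g f + scomp g' f.
Proof.
have [[h0 ->] [g0 ->] [f0 ->]] := And3 (sclassP g) (sclassP g') (sclassP f).
by rewrite -sclassD !scompE compDl sclassD.
Qed.

Lemma scompDr X Y Z (g : shom Y Z) (f f' : shom X Y) :
  scomp g (f + f') = scomp g f + scomp g f'.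
Proof.
have [[h0 ->] [g0 ->] [f0 ->]] := And3 (sclassP g) (sclassP f) (sclassP f').
by rewrite -sclassD !scompE compDr sclassD.
Qed.

Definition stable_preadditive : preadditive :=
  @Preadditive C shom (fun X => sclass (idm X)) scomp
    scomp1m scompm1 scompA scompDl scompDr.

(* A chosen conflation X -> I(X) -> Σ X with I(X) injective; another choice
   changes the shift functor by a canonical natural isomorphism. *)
Definition inj_choice X : injective_embedding (@conflation C) X :=
  projT1 (cid (let: inhabits r := frob_enough_inj X in ex_intro (fun=> True) r I)).

Definition Inj X : C := inj_mid (inj_choice X).
Definition Sigma X : C := inj_coker (inj_choice X).
Definition mu X : hom X (Inj X) := inj_in (inj_choice X).
Definition pi X : hom (Inj X) (Sigma X) := inj_out (inj_choice X).

Definition shift_rel X Y (f : hom X Y) (g : hom (Sigma X) (Sigma Y)) :=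
  exists h : hom (Inj X) (Inj Y), h ∘ mu X = mu Y ∘ f /\ g ∘ pi X = pi Y ∘ h.

Lemma mu_pi_conflation X : conflation (mu X) (pi X).
Proof. exact: inj_conflation. Qed.

Lemma Inj_injective X : injective_object (@conflation C) (Inj X).
Proof. exact: inj_injective. Qed.

Lemma mu_inflation X : inflation (@conflation C) (mu X).
Proof. by exists (Sigma X), (pi X); exact: mu_pi_conflation. Qed.

Lemma pi_epi X Y (f g : hom (Sigma X) Y) : f ∘ pi X = g ∘ pi X -> f = g.
Proof.
move=> e; have [z H] := conflation_cokernel (frob_exact C) (mu_pi_conflation X).
have [|u [_ uP]] := H _ (f ∘ pi X); first by rewrite -compA z compm0.
by rewrite -(uP f erefl) -(uP g (esym e)).
Qed.

Lemma shift_rel_ex X Y (f : hom X Y) : exists g, shift_rel f g.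
Proof.
have [h hP] := Inj_injective (mu Y ∘ f) (mu_inflation X).
have [_ H] := conflation_cokernel (frob_exact C) (mu_pi_conflation X).
have [z _] := conflation_cokernel (frob_exact C) (mu_pi_conflation Y).
have [|g [gP _]] := H _ (pi Y ∘ h); first by rewrite -compA hP compA z comp0m.
by exists g, h.
Qed.

Lemma shift_rel_null X Y (f f' : hom X Y) g g' :
  shift_rel f g -> shift_rel f' g' -> stably_null (f - f') -> stably_null (g - g').
Proof.
move=> [h [e1 e2]] [h' [e1' e2']] [Q [a [b [Qp e]]]].
have [a' a'P] : exists a', a' ∘ mu X = a.
  by apply: (iffLR (frob_proj_inj Q)) => //; exact: mu_inflation.
have [z H] := conflation_cokernel (frob_exact C) (mu_pi_conflation X).
have [z' _] := conflation_cokernel (frob_exact C) (mu_pi_conflation Y).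
have [|t [tP _]] := H _ (h - h' - mu Y ∘ b ∘ a').
  by rewrite !compBl e1 e1' -[_ ∘ a' ∘ _]compA a'P -compA -e compBr subrr.
exists (Inj Y), t, (pi Y); split.
  by apply/frob_proj_inj; exact: Inj_injective.
apply: pi_epi; rewrite -compA tP compBl e2 e2' !compBr !compA z' !comp0m.
by rewrite subr0.
Qed.

Definition shift_map X Y (f : shom X Y) : shom (Sigma X) (Sigma Y) :=
  sclass (projT1 (cid (shift_rel_ex (srepr f)))).

Lemma shift_mapE X Y (f : hom X Y) g :
  shift_rel f g -> shift_map (sclass f) = sclass g.
Proof.
move=> fg; rewrite /shift_map; case: cid => g' /= fg'.
by apply/sclass_eq/(shift_rel_null fg' fg)/sclass_eq; rewrite sreprK.
Qed.

Lemma shift_map1 X : shift_map (sclass (idm X)) = sclass (idm (Sigma X)).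
Proof.
by apply: shift_mapE; exists (idm _); rewrite !comp1m !compm1.
Qed.

Lemma shift_mapM X Y Z (g : shom Y Z) (f : shom X Y) :
  shift_map (scomp g f) = scomp (shift_map g) (shift_map f).
Proof.
have [g0 ->] := sclassP g; have [f0 ->] := sclassP f.
have [g1 gP] := shift_rel_ex g0; have [f1 fP] := shift_rel_ex f0.
rewrite scompE (shift_mapE gP) (shift_mapE fP) scompE.
apply: shift_mapE; case: gP fP => [h [e1 e2]] [h' [e1' e2']].
exists (h ∘ h'); split; first by rewrite -compA e1' !compA e1.
by rewrite -compA e2' !compA e2.
Qed.

Definition stable_shift : functor stable_preadditive stable_preadditive :=
  @Functor stable_preadditive stable_preadditive Sigma shift_map
    shift_map1 shift_mapM.

(* The connecting morphism w of a conflation (i, p) is given by a morphism of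
   conflations from (i, p) to (mu X, pi X) that is the identity on X. *)
Definition connecting X Y Z (i : hom X Y) (p : hom Y Z) (w : hom Z (Sigma X)) :=
  exists h : hom Y (Inj X), h ∘ i = mu X /\ w ∘ p = pi X ∘ h.

(* The triangles isomorphic, in the stable category, to X -> Y -> Z -> Σ X with
   morphisms the classes of i, p, -w for a conflation (i, p).  The sign is that
   of Happel's lemma describing in this way the triangles obtained from his
   standard ones, the pushouts of (mu X, pi X). *)
Definition stable_distinguished (X Y Z : stable_preadditive)
    (u : hom X Y) (v : hom Y Z) (w : hom Z (stable_shift X)) :=
  exists (X' Y' Z' : C) (i : hom X' Y') (p : hom Y' Z') (w' : hom Z' (Sigma X'))
         (a : @hom stable_preadditive X' X) (b : @hom stable_preadditive Y' Y)
         (c : @hom stable_preadditive Z' Z),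
    [/\ conflation i p, connecting i p w',
        [/\ is_iso a, is_iso b & is_iso c]
      & [/\ u ∘ a = b ∘ sclass i, v ∘ b = c ∘ sclass p
          & w ∘ c = fmap stable_shift a ∘ (- sclass w')]].

Definition stable : triangle_category :=
  @TriangleCategory stable_preadditive stable_shift stable_distinguished.

End Stable.

(** * Modules *)

Section Modules.
Variable S : comNzRingType.
Implicit Types U V W : lmodType S.

Definition finitely_generated (M : lmodType S) :=
  exists (k : nat) (g : 'I_k -> M),
    forall x, exists a : 'I_k -> S, x = \sum_(i < k) a i *: g i.

Definition projective_module (P : lmodType S) :=
  forall (M N : lmodType S) (p : {linear M -> N}) (f : {linear P -> N}),
    (forall y, exists x, p x = y) ->
    exists h : {linear P -> M}, forall x, p (h x) = f x.

Record fgproj := FGProj {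
  fgproj_mod :> lmodType S;
  fgproj_fg : finitely_generated fgproj_mod;
  fgproj_proj : projective_module fgproj_mod }.

Record short_exact U V W (i : {linear U -> V}) (p : {linear V -> W}) : Prop :=
  ShortExact {
    ses_inj : injective i;
    ses_surj : forall z, exists y, p y = z;
    ses_ker : forall y, p y = 0 <-> exists x, i x = y }.

Lemma linear_ext U V (f g : {linear U -> V}) : f =1 g -> f = g.
Proof.
case: f g => f [[fD] [fZ]] [g [[gD] [gZ]]] /= /funext e; subst g.
by rewrite (Prop_irrelevance fD gD) (Prop_irrelevance fZ gZ).
Qed.

Definition lpair U V W (f : {linear U -> V}) (g : {linear U -> W}) (x : U) :
  V * W := (f x, g x).

Lemma lpair_linear U V W (f : {linear U -> V}) (g : {linear U -> W}) :
  linear (lpair f g).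
Proof. by move=> a x y; rewrite /lpair !linearP. Qed.

HB.instance Definition _ U V W (f : {linear U -> V}) (g : {linear U -> W}) :=
  GRing.isLinear.Build S U (V * W)%type _ (lpair f g) (lpair_linear f g).

Lemma inj_lift U V W (i : {linear U -> V}) (t : {linear W -> V}) :
  injective i -> (forall z, exists x, i x = t z) ->
  {u : {linear W -> U} | forall z, i (u z) = t z}.
Proof.
move=> inji ex; pose u z := projT1 (cid (ex z)).
have uE z : i (u z) = t z by rewrite /u; case: cid.
have ulin : linear u.
  by move=> a x y; apply: inji; rewrite uE !linearP !uE.
pose ul := GRing.isLinear.Build S W U _ u ulin.
pose U' : {linear W -> U} := HB.pack u ul.
by exists U'.
Qed.

Lemma ses_split (X Y Z : fgproj) (i : {linear X -> Y}) (p : {linear Y -> Z}) :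
  short_exact i p ->
  exists (s : {linear Z -> Y}) (r : {linear Y -> X}),
    [/\ forall z, p (s z) = z, forall x, r (i x) = x,
        forall y, i (r y) = y - s (p y) & forall z, r (s z) = 0].
Proof.
move=> [inji surjp ker].
have [s sE] := fgproj_proj (idfun : {linear Z -> Z}) surjp.
have [|r rE] := @inj_lift _ _ _ i (idfun \- (s \o p) : {linear Y -> Y}) inji.
  by move=> y; apply/ker; rewrite /= linearB /= sE /= subrr.
exists s, r; split=> // [x|z]; apply: inji; rewrite rE /=.
  have -> : p (i x) = 0 by apply/ker; exists x.
  by rewrite linear0 subr0.
by rewrite sE /= subrr linear0.
Qed.

Lemma fg_prod U V :
  finitely_generated U -> finitely_generated V -> finitely_generated (U * V)%type.
Proof.
move=> [k [g gP]] [l [h hP]].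
exists (k + l)%N, (fun i => match split i with inl i => (g i, 0) | inr i => (0, h i) end).
move=> [x y]; have [a ->] := gP x; have [b ->] := hP y.
exists (fun i => match split i with inl i => a i | inr i => b i end).
have El (i : 'I_k) : split (lshift l i) = inl i by exact: (unsplitK (inl i)).
have Er (i : 'I_l) : split (rshift k i) = inr i by exact: (unsplitK (inr i)).
rewrite big_split_ord /= (eq_bigr (fun i => a i *: (g i, 0))); last first.
  by move=> i _; rewrite El.
rewrite [X in _ + X](eq_bigr (fun i => b i *: (0, h i))); last first.
  by move=> i _; rewrite Er.
have fstE (n : nat) (F : 'I_n -> U * V) : (\sum_i F i).1 = \sum_i (F i).1.
  exact: (raddf_sum (fst : {linear (U * V)%type -> U})).
have sndE (n : nat) (F : 'I_n -> U * V) : (\sum_i F i).2 = \sum_i (F i).2.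
  exact: (raddf_sum (snd : {linear (U * V)%type -> V})).
apply/pair_equal_spec; rewrite !fstE !sndE /=.
split; [rewrite [X in _ + X]big1 ?addr0 | rewrite [X in X + _]big1 ?add0r];
  by [apply: eq_bigr | move=> i _; rewrite scaler0].
Qed.

Lemma proj_prod U V :
  projective_module U -> projective_module V -> projective_module (U * V)%type.
Proof.
move=> PU PV M N p f surjp.
have [a aE] := PU _ _ p (f \o lpair idfun \0 : {linear U -> N}) surjp.
have [b bE] := PV _ _ p (f \o lpair \0 idfun : {linear V -> N}) surjp.
exists ((a \o fst) \+ (b \o snd) : {linear (U * V)%type -> M}) => -[x y] /=.
rewrite linearD /= aE bE /= -linearD; congr (f _).
by rewrite /lpair /=; congr (_, _); rewrite ?addr0 ?add0r.
Qed.

Definition fgprod (P Q : fgproj) : fgproj :=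
  FGProj (fg_prod (fgproj_fg P) (fgproj_fg Q))
         (proj_prod (@fgproj_proj P) (@fgproj_proj Q)).

Lemma fg_zero : finitely_generated 'rV[S]_0.
Proof.
by exists 0%N, (fun=> 0) => x; exists (fun=> 0); rewrite big_ord0 [x]thinmx0.
Qed.

Lemma proj_zero : projective_module 'rV[S]_0.
Proof.
move=> M N p f _; exists \0 => x.
by rewrite [x]thinmx0 !linear0.
Qed.

Definition fgzero : fgproj := FGProj fg_zero proj_zero.

Lemma fgzero_eq0 (x : fgzero) : x = 0.
Proof. exact: thinmx0. Qed.

Lemma lreg_fgproj (w : S) (P : fgproj) :
  GRing.lreg w -> injective (fun x : P => w *: x).
Proof.
move=> wreg; have [k [g gP]] := fgproj_fg P.
pose c (v : 'rV[S]_k) : P := \sum_(i < k) v 0 i *: g i.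
have clin : linear c.
  move=> a u v; rewrite /c scaler_sumr -big_split /=; apply: eq_bigr => i _.
  by rewrite !mxE scalerDl scalerA.
pose cl := GRing.isLinear.Build S 'rV[S]_k P _ c clin.
pose C : {linear 'rV[S]_k -> P} := HB.pack c cl.
have [|h hE] := fgproj_proj (p := C) (idfun : {linear P -> P}).
  move=> x; have [a ->] := gP x; exists (\row_i a i).
  by apply: eq_bigr => i _; rewrite mxE.
move=> x y e; rewrite -[x]/(idfun x) -[y]/(idfun y) -!hE; congr (C _).
apply/rowP => i; apply: wreg.
by have /rowP/(_ i) := congr1 h e; rewrite !linearZ !mxE.
Qed.

(* A morphism of short exact sequences that is the identity on the right (resp.
   on the left) term: its left (resp. right) square is a pushout (resp. a
   pullback). *)
Section Push.
Variables (X Y Z X' Y' : fgproj).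
Variables (i : {linear X -> Y}) (p : {linear Y -> Z}).
Variables (i' : {linear X' -> Y'}) (p' : {linear Y' -> Z}).
Variables (g : {linear X -> X'}) (g' : {linear Y -> Y'}).
Hypotheses (ip : short_exact i p) (ip' : short_exact i' p').
Hypotheses (gi : forall x, g' (i x) = i' (g x)) (pg : forall y, p' (g' y) = p y).

Lemma push_epi y' : exists y x', y' = g' y + i' x'.
Proof.
have [y yE] := ses_surj ip (p' y').
have /(ses_ker ip') [x' x'E] : p' (y' - g' y) = 0 by rewrite linearB pg yE subrr.
by exists y, x'; rewrite x'E addrC subrK.
Qed.

Lemma push_univ (T : lmodType S) (a : {linear Y -> T}) (b : {linear X' -> T}) :
  (forall x, a (i x) = b (g x)) ->
  {c : {linear Y' -> T} | (forall y, c (g' y) = a y) /\ (forall x, c (i' x) = b x)}.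
Proof.
move=> ab; apply: cid.
have [s [r [ps ri ir rs]]] := ses_split ip.
have [|r' r'E] := @inj_lift _ _ _ i'
    (idfun \- (g' \o s \o p') : {linear Y' -> Y'}) (ses_inj ip').
  by move=> y; apply/(ses_ker ip'); rewrite linearB /= pg ps subrr.
exists ((b \o r') \+ (a \o s \o p') : {linear Y' -> T}); split=> [y|x] /=.
  have -> : r' (g' y) = g (r y).
    by apply: (ses_inj ip'); rewrite r'E /= pg -linearB -ir gi.
  by rewrite -ab ir pg -linearD subrK.
have px : p' (i' x) = 0 by apply/(ses_ker ip'); exists x.
have -> : r' (i' x) = x.
  by apply: (ses_inj ip'); rewrite r'E /= px !linear0 addr0.
by rewrite px !linear0 addr0.
Qed.

Lemma push_ses (W : fgproj) (k : {linear W -> X}) :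
  short_exact k g -> short_exact (i \o k) g'.
Proof.
move=> kg; split=> [x x' /(ses_inj ip)/(ses_inj kg) //|y'|y].
  have [y [x' ->]] := push_epi y'; have [x <-] := ses_surj kg x'.
  by exists (y + i x); rewrite linearD gi.
split=> [y0|[x <-]].
  have /(ses_ker ip) [x xE] : p y = 0 by rewrite -pg y0 linear0.
  have /(ses_ker kg) [v vE] : g x = 0.
    by apply: (ses_inj ip'); rewrite linear0 -gi xE.
  by exists v; rewrite /= vE.
rewrite /= gi (_ : g _ = 0) ?linear0 //.
by apply/(ses_ker kg); exists x.
Qed.

End Push.

Section Pull.
Variables (X Y Z Y' Z' : fgproj).
Variables (i : {linear X -> Y}) (p : {linear Y -> Z}).
Variables (i' : {linear X -> Y'}) (p' : {linear Y' -> Z'}).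
Variables (g : {linear Z' -> Z}) (g' : {linear Y' -> Y}).
Hypotheses (ip : short_exact i p) (ip' : short_exact i' p').
Hypotheses (gi : forall x, g' (i' x) = i x) (pg : forall y, p (g' y) = g (p' y)).

Lemma pull_mono y y' : g' y = g' y' -> p' y = p' y' -> y = y'.
Proof.
move=> e1 e2; apply/eqP; rewrite -subr_eq0; apply/eqP.
have /(ses_ker ip') [x xE] : p' (y - y') = 0 by rewrite linearB e2 subrr.
rewrite -xE; suff -> : x = 0 by rewrite linear0.
by apply: (ses_inj ip); rewrite -gi xE linearB e1 subrr linear0.
Qed.

Lemma pull_univ (T : lmodType S) (a : {linear T -> Y}) (b : {linear T -> Z'}) :
  (forall t, p (a t) = g (b t)) ->
  {c : {linear T -> Y'} | (forall t, g' (c t) = a t) /\ (forall t, p' (c t) = b t)}.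
Proof.
move=> ab; apply: cid.
have [s' [_ [ps' _ _ _]]] := ses_split ip'.
have [|u uE] := @inj_lift _ _ _ i (a \- (g' \o s' \o b) : {linear T -> Y}) (ses_inj ip).
  by move=> t; apply/(ses_ker ip); rewrite linearB /= pg ps' ab subrr.
exists ((i' \o u) \+ (s' \o b) : {linear T -> Y'}); split=> t /=.
  by rewrite linearD gi uE /= subrK.
rewrite linearD ps' (_ : p' _ = 0) ?add0r //.
by apply/(ses_ker ip'); exists (u t).
Qed.

Lemma pull_ses (W : fgproj) (q : {linear Z -> W}) :
  short_exact g q -> short_exact g' (q \o p).
Proof.
move=> gq; split=> [y y' e|v|y].
- by apply: pull_mono => //; apply: (ses_inj gq); rewrite -!pg e.
- have [z <-] := ses_surj gq v; have [y <-] := ses_surj ip z.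
  by exists y.
split=> [/(ses_ker gq) [z zE]|[y' <-]].
  have [y' y'E] := ses_surj ip' z.
  have /(ses_ker ip) [x xE] : p (y - g' y') = 0.
    by rewrite linearB pg y'E zE subrr.
  by exists (i' x + y'); rewrite linearD gi xE subrK.
by rewrite /= pg; apply/(ses_ker gq); exists (p' y').
Qed.

End Pull.

Lemma ses_iso (X Y Z X' Y' Z' : lmodType S)
    (i : {linear X -> Y}) (p : {linear Y -> Z})
    (i' : {linear X' -> Y'}) (p' : {linear Y' -> Z'})
    (a : {linear X -> X'}) (b : {linear Y -> Y'}) (c : {linear Z -> Z'}) :
  bijective a -> bijective b -> bijective c ->
  (forall x, b (i x) = i' (a x)) -> (forall y, c (p y) = p' (b y)) ->
  short_exact i p -> short_exact i' p'.
Proof.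
move=> [a' aK aK'] [b' bK bK'] [c' cK cK'] e1 e2 [inji surjp ker].
split=> [x x'|z|y].
- rewrite -(aK' x) -(aK' x') -!e1 => /(can_inj bK)/inji.
  by move=> ->.
- have [y yE] := surjp (c' z); exists (b y).
  by rewrite -e2 yE cK'.
rewrite -(bK' y) -e2; split=> [e|[x xE]].
  have /ker [x xE] : p (b' y) = 0 by apply: (can_inj cK); rewrite e linear0.
  by exists (a x); rewrite -e1 xE.
rewrite (_ : p _ = 0) ?linear0 //; apply/ker; exists (a' x).
by apply: (can_inj bK); rewrite e1 aK'.
Qed.

Lemma ses_kernel (X Y Z T : lmodType S)
    (i : {linear X -> Y}) (p : {linear Y -> Z}) (t : {linear T -> Y}) :
  short_exact i p -> (forall x, p (t x) = 0) ->
  {u : {linear T -> X} | forall x, i (u x) = t x}.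
Proof.
move=> ip pt; apply: inj_lift; first exact: (ses_inj ip).
by move=> x; apply/(ses_ker ip).
Qed.

Lemma ses_cokernel (X Y Z : fgproj) (T : lmodType S)
    (i : {linear X -> Y}) (p : {linear Y -> Z}) (t : {linear Y -> T}) :
  short_exact i p -> (forall x, t (i x) = 0) ->
  {u : {linear Z -> T} | forall y, u (p y) = t y}.
Proof.
move=> ip ti; apply: cid; have [s [r [_ _ ir _]]] := ses_split ip.
exists (t \o s : {linear Z -> T}) => y /=.
by apply/eqP; rewrite -subr_eq0 -linearB -opprB linearN -ir ti oppr0.
Qed.

Lemma ses_zero (X Y Z : lmodType S) (i : {linear X -> Y}) (p : {linear Y -> Z}) x :
  short_exact i p -> p (i x) = 0.
Proof. by move=> ip; apply/(ses_ker ip); exists x. Qed.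

Lemma ses_idl (X : fgproj) :
  short_exact (idfun : {linear X -> X}) (\0 : {linear X -> fgzero}).
Proof.
split=> // [z|y]; first by exists 0; rewrite [z]fgzero_eq0.
by split=> // _; exists y.
Qed.

Lemma ses_idr (X : fgproj) :
  short_exact (\0 : {linear fgzero -> X}) (idfun : {linear X -> X}).
Proof.
split=> [x y _|z|y]; first by rewrite [x]fgzero_eq0 [y]fgzero_eq0.
  by exists z.
by split=> [/= ->|[x <-]] //; exists 0.
Qed.

Lemma ses_prod (X Z : fgproj) :
  short_exact (lpair idfun \0 : {linear X -> fgprod X Z})
              (snd : {linear fgprod X Z -> Z}).
Proof.
split=> [x y []//|z|[x z]]; first by exists (0, z).
by split=> [/= ->|[x' [_ <-]]] //; exists x.
Qed.

End Modules.

Section Rings.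
Variable S : comNzRingType.
Implicit Types I J n : {pred S}.

(* [idealr_closed I] says that I is a proper ideal.  The improper ideal is
   generated by 1, so that proper ideals suffice here. *)
Definition noetherian := forall I, idealr_closed I ->
  exists (k : nat) (g : 'I_k -> S),
    forall x, x \in I <-> exists a : 'I_k -> S, x = \sum_(i < k) a i * g i.

Definition maximal_ideal n :=
  idealr_closed n /\
  forall J, idealr_closed J -> {subset n <= J} -> {subset J <= n}.

Definition local_ring n := maximal_ideal n /\ forall J, maximal_ideal J -> J =i n.

End Rings.

Arguments noetherian : clear implicits.

(** * The category Mon(w, P) *)

Section Mon.
Variables (S : comNzRingType) (w : S).

(* [mon_coker] is w Coker f = 0, that is, w P0 is contained in f(P1). *)
Record mon_obj := MonObj {
  mon1 : fgproj S;
  mon0 : fgproj S;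
  mon_map : {linear mon1 -> mon0};
  mon_inj : injective mon_map;
  mon_coker : forall y, exists x, mon_map x = w *: y }.

Record mon_hom (X Y : mon_obj) := MonHom {
  mhom1 : {linear mon1 X -> mon1 Y};
  mhom0 : {linear mon0 X -> mon0 Y};
  mhomE : forall x, mon_map Y (mhom1 x) = mhom0 (mon_map X x) }.

Implicit Types X Y Z T : mon_obj.

Lemma mhom_ext X Y (f g : mon_hom X Y) :
  mhom1 f =1 mhom1 g -> mhom0 f =1 mhom0 g -> f = g.
Proof.
case: f g => [f1 f0 fE] [g1 g0 gE] /= /linear_ext e1 /linear_ext e0.
by subst g1 g0; rewrite (Prop_irrelevance fE gE).
Qed.

Lemma mhom_zero_subproof X Y (x : mon1 X) :
  mon_map Y ((\0 : {linear mon1 X -> mon1 Y}) x)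
  = (\0 : {linear mon0 X -> mon0 Y}) (mon_map X x).
Proof. exact: linear0. Qed.

Definition mhom_zero X Y := MonHom (@mhom_zero_subproof X Y).

Lemma mhom_opp_subproof X Y (f : mon_hom X Y) x :
  mon_map Y ((\- mhom1 f) x) = (\- mhom0 f) (mon_map X x).
Proof. by rewrite /= linearN mhomE. Qed.

Definition mhom_opp X Y (f : mon_hom X Y) := MonHom (mhom_opp_subproof f).

Lemma mhom_add_subproof X Y (f g : mon_hom X Y) x :
  mon_map Y ((mhom1 f \+ mhom1 g) x) = (mhom0 f \+ mhom0 g) (mon_map X x).
Proof. by rewrite /= linearD !mhomE. Qed.

Definition mhom_add X Y (f g : mon_hom X Y) := MonHom (mhom_add_subproof f g).

Lemma mhom_addA X Y : associative (@mhom_add X Y).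
Proof. by move=> f g h; apply: mhom_ext => x /=; rewrite addrA. Qed.

Lemma mhom_addC X Y : commutative (@mhom_add X Y).
Proof. by move=> f g; apply: mhom_ext => x /=; rewrite addrC. Qed.

Lemma mhom_add0 X Y : left_id (mhom_zero X Y) (@mhom_add X Y).
Proof. by move=> f; apply: mhom_ext => x /=; rewrite add0r. Qed.

Lemma mhom_addN X Y : left_inverse (mhom_zero X Y) (@mhom_opp X Y) (@mhom_add X Y).
Proof. by move=> f; apply: mhom_ext => x /=; rewrite addNr. Qed.

HB.instance Definition _ X Y := gen_eqMixin (mon_hom X Y).
HB.instance Definition _ X Y := gen_choiceMixin (mon_hom X Y).
HB.instance Definition _ X Y := GRing.isZmodule.Build (mon_hom X Y)
  (@mhom_addA X Y) (@mhom_addC X Y) (@mhom_add0 X Y) (@mhom_addN X Y).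

Definition mhom_id X : mon_hom X X :=
  @MonHom X X idfun idfun (fun=> erefl).

Lemma mhom_comp_subproof X Y Z (g : mon_hom Y Z) (f : mon_hom X Y) x :
  mon_map Z ((mhom1 g \o mhom1 f) x) = (mhom0 g \o mhom0 f) (mon_map X x).
Proof. by rewrite /= !mhomE. Qed.

Definition mhom_comp X Y Z (g : mon_hom Y Z) (f : mon_hom X Y) : mon_hom X Z :=
  MonHom (mhom_comp_subproof g f).

Lemma mhom_comp1m X Y (f : mon_hom X Y) : mhom_comp (mhom_id Y) f = f.
Proof. exact: mhom_ext. Qed.

Lemma mhom_compm1 X Y (f : mon_hom X Y) : mhom_comp f (mhom_id X) = f.
Proof. exact: mhom_ext. Qed.

Lemma mhom_compA X Y Z T (h : mon_hom Z T) (g : mon_hom Y Z) (f : mon_hom X Y) :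
  mhom_comp h (mhom_comp g f) = mhom_comp (mhom_comp h g) f.
Proof. exact: mhom_ext. Qed.

Lemma mhom_compDl X Y Z (g g' : mon_hom Y Z) (f : mon_hom X Y) :
  mhom_comp (g + g') f = mhom_comp g f + mhom_comp g' f.
Proof. exact: mhom_ext. Qed.

Lemma mhom_compDr X Y Z (g : mon_hom Y Z) (f f' : mon_hom X Y) :
  mhom_comp g (f + f') = mhom_comp g f + mhom_comp g f'.
Proof. by apply: mhom_ext => x /=; rewrite linearD. Qed.

Definition mon_cat : preadditive :=
  @Preadditive mon_obj mon_hom mhom_id mhom_comp
    mhom_comp1m mhom_compm1 mhom_compA mhom_compDl mhom_compDr.

Definition mon_conflation : sequence_class mon_cat := fun X Y Z i p =>
  short_exact (mhom1 i) (mhom1 p) /\ short_exact (mhom0 i) (mhom0 p).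

(** ** Mon(w, P) is a Frobenius category *)


Lemma mhom1E (X Y : mon_cat) (f g : mon_hom X Y) x : f = g -> mhom1 f x = mhom1 g x.
Proof. by move->. Qed.

Lemma mhom0E (X Y : mon_cat) (f g : mon_hom X Y) x : f = g -> mhom0 f x = mhom0 g x.
Proof. by move->. Qed.

Lemma mon_exact_zero (X Y Z : mon_cat) (i : hom X Y) (p : hom Y Z) :
  mon_conflation i p -> p ∘ i = 0.
Proof. by move=> [c1 c0]; apply: mhom_ext => x; apply: ses_zero. Qed.

Lemma mon_conflation_kernel (X Y Z : mon_cat) (i : hom X Y) (p : hom Y Z) :
  mon_conflation i p -> kernel_of i p.
Proof.
move=> ip; have [c1 c0] := ip; split=> [|T t pt]; first exact: mon_exact_zero.
have [u1 u1E] := ses_kernel c1 (fun x => mhom1E x pt).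
have [u0 u0E] := ses_kernel c0 (fun x => mhom0E x pt).
have uE x : mon_map X (u1 x) = u0 (mon_map T x).
  by apply: (ses_inj c0); rewrite u0E -!mhomE u1E.
exists (MonHom uE); split=> [|v vE]; first exact: mhom_ext.
apply: mhom_ext => x /=.
  by apply: (ses_inj c1); rewrite u1E -(mhom1E x vE).
by apply: (ses_inj c0); rewrite u0E -(mhom0E x vE).
Qed.

Lemma mon_conflation_cokernel (X Y Z : mon_cat) (i : hom X Y) (p : hom Y Z) :
  mon_conflation i p -> cokernel_of i p.
Proof.
move=> ip; have [c1 c0] := ip; split=> [|T t ti]; first exact: mon_exact_zero.
have [u1 u1E] := ses_cokernel c1 (fun x => mhom1E x ti).
have [u0 u0E] := ses_cokernel c0 (fun x => mhom0E x ti).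
have uE x : mon_map T (u1 x) = u0 (mon_map Z x).
  by have [y <-] := ses_surj c1 x; rewrite mhomE u1E u0E mhomE.
exists (MonHom uE); split=> [|v vE]; first exact: mhom_ext.
apply: mhom_ext => x /=.
  by have [y <-] := ses_surj c1 x; rewrite u1E -(mhom1E y vE).
by have [y <-] := ses_surj c0 x; rewrite u0E -(mhom0E y vE).
Qed.

Lemma mon_iso_bij (X Y : mon_cat) (f : hom X Y) :
  is_iso f -> bijective (mhom1 f) /\ bijective (mhom0 f).
Proof.
move=> [g [e1 e2]]; split; [exists (mhom1 g) | exists (mhom0 g)] => x.
- exact: (mhom1E x e1).
- exact: (mhom1E x e2).
- exact: (mhom0E x e1).
- exact: (mhom0E x e2).
Qed.

Lemma mon_conflation_iso (X Y Z X' Y' Z' : mon_cat)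
    (i : hom X Y) (p : hom Y Z)
    (i' : hom X' Y') (p' : hom Y' Z')
    (a : hom X X') (b : hom Y Y') (c : hom Z Z') :
  is_iso a -> is_iso b -> is_iso c -> b ∘ i = i' ∘ a -> c ∘ p = p' ∘ b ->
  mon_conflation i p -> mon_conflation i' p'.
Proof.
move=> /mon_iso_bij[a1 a0] /mon_iso_bij[b1 b0] /mon_iso_bij[c1 c0] e1 e2 [ip1 ip0].
split.
  exact: (ses_iso a1 b1 c1 (fun x => mhom1E x e1) (fun x => mhom1E x e2)).
exact: (ses_iso a0 b0 c0 (fun x => mhom0E x e1) (fun x => mhom0E x e2)).
Qed.

Lemma mon_zero_inj : injective (\0 : {linear fgzero S -> fgzero S}).
Proof. by move=> x y _; rewrite [x]fgzero_eq0 [y]fgzero_eq0. Qed.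

Lemma mon_zero_coker (y : fgzero S) :
  exists x, (\0 : {linear fgzero S -> fgzero S}) x = w *: y.
Proof. by exists 0; rewrite [_ *: _]fgzero_eq0 linear0. Qed.

Definition mon_zero := MonObj mon_zero_inj mon_zero_coker.

Lemma mon_inflation_id (X : mon_cat) : inflation mon_conflation (idm X).
Proof. by exists mon_zero, (0 : mon_hom X mon_zero); split; exact: ses_idl. Qed.

Lemma mon_deflation_id (X : mon_cat) : deflation mon_conflation (idm X).
Proof. by exists mon_zero, (0 : mon_hom mon_zero X); split; exact: ses_idr. Qed.

(* The extension of Z by X whose structure map is upper triangular, with
   off-diagonal entry t. *)
Section Twist.
Variables (X Z : mon_obj) (t : {linear mon1 Z -> mon0 X}).
Hypothesis tP : forall (z0 : mon0 Z) (z1 : mon1 Z), mon_map Z z1 = w *: z0 ->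
  exists x1, mon_map X x1 = t z1.

Definition mon_twist_map : {linear fgprod (mon1 X) (mon1 Z) -> fgprod (mon0 X) (mon0 Z)} :=
  lpair ((mon_map X \o fst) \+ (t \o snd)) (mon_map Z \o snd).

Lemma mon_twist_inj : injective mon_twist_map.
Proof.
by move=> [x z] [x' z'] [] /= + /mon_inj e; rewrite e => /addIr/mon_inj ->.
Qed.

Lemma mon_twist_coker y : exists x, mon_twist_map x = w *: y.
Proof.
case: y => x0 z0; have [z1 z1E] := mon_coker z0.
have [x1 x1E] := tP z1E; have [x2 x2E] := mon_coker x0.
by exists (x2 - x1, z1); rewrite /mon_twist_map /= /lpair /= linearB z1E x1E x2E subrK.
Qed.

Definition mon_twist := MonObj mon_twist_inj mon_twist_coker.

Lemma mon_twist_in_subproof x :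
  mon_map mon_twist ((lpair idfun \0 : {linear mon1 X -> mon1 mon_twist}) x)
  = (lpair idfun \0 : {linear mon0 X -> mon0 mon_twist}) (mon_map X x).
Proof. by rewrite /= /mon_twist_map /= /lpair /= !linear0 addr0. Qed.

Definition mon_twist_in := MonHom mon_twist_in_subproof.

Definition mon_twist_out : mon_hom mon_twist Z :=
  @MonHom mon_twist Z snd snd (fun=> erefl).

Lemma mon_twist_conflation : mon_conflation mon_twist_in mon_twist_out.
Proof. by split; exact: ses_prod. Qed.

End Twist.

Lemma mon_additive : additive_category mon_cat.
Proof.
split.
  by exists mon_zero; apply: mhom_ext => x; rewrite [LHS]fgzero_eq0 [RHS]fgzero_eq0.
move=> X Y; pose t : {linear mon1 Y -> mon0 X} := \0.
have tP (y0 : mon0 Y) (y1 : mon1 Y) : mon_map Y y1 = w *: y0 ->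
    exists x1, mon_map X x1 = t y1.
  by move=> _; exists 0; rewrite linear0.
have i2E x : mon_map (mon_twist tP) ((lpair \0 idfun : {linear mon1 Y -> fgprod _ _}) x)
    = (lpair \0 idfun : {linear mon0 Y -> fgprod _ _}) (mon_map Y x).
  by rewrite /= /mon_twist_map /= /lpair /= linear0 addr0.
have p1E (x : mon1 (mon_twist tP)) : mon_map X (fst x) = fst (mon_map (mon_twist tP) x).
  by rewrite /= /mon_twist_map /= /lpair /= addr0.
exists (mon_twist tP), (mon_twist_in tP), (@MonHom Y (mon_twist tP) _ _ i2E).
exists (@MonHom (mon_twist tP) X fst fst p1E), (mon_twist_out tP).
by split; apply: mhom_ext => // -[x y]; rewrite /= /lpair /=;
  congr (_, _); rewrite /= ?addr0 ?add0r.
Qed.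

Lemma mon_pushout (X Y Z X' : mon_cat) (i : hom X Y) (p : hom Y Z)
    (g : hom X X') :
  mon_conflation i p ->
  exists (Y' : mon_cat) (g' : hom Y Y') (i' : hom X' Y') (p' : hom Y' Z),
    [/\ mon_conflation i' p', g' ∘ i = i' ∘ g & p' ∘ g' = p].
Proof.
move=> ip; have [c1 c0] := ip.
have [s1 [r1 [ps1 ri1 ir1 rs1]]] := ses_split c1.
have [s0 [r0 [ps0 ri0 ir0 rs0]]] := ses_split c0.
pose t := mhom0 g \o r0 \o mon_map Y \o s1 : {linear mon1 Z -> mon0 X'}.
have rE y : r0 (mon_map Y y) = mon_map X (r1 y) + r0 (mon_map Y (s1 (mhom1 p y))).
  rewrite -[y in LHS](subrK (s1 (mhom1 p y))) -ir1 !linearD /=.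
  by rewrite mhomE ri0.
have tP (z0 : mon0 Z) (z1 : mon1 Z) : mon_map Z z1 = w *: z0 ->
    exists x1, mon_map X' x1 = t z1.
  move=> e; have [y1 y1E] := mon_coker (s0 z0).
  have pE : mhom1 p y1 = z1.
    by apply: (@mon_inj Z); rewrite mhomE y1E linearZ /= ps0 e.
  have := rE y1; rewrite y1E linearZ /= rs0 scaler0 pE => /esym/eqP.
  rewrite addrC addr_eq0 => /eqP rE1.
  by exists (- mhom1 g (r1 y1)); rewrite /t /= rE1 !linearN /= mhomE.
have gE y : mon_map (mon_twist tP)
    ((lpair (mhom1 g \o r1) (mhom1 p) : {linear mon1 Y -> fgprod _ _}) y)
    = (lpair (mhom0 g \o r0) (mhom0 p) : {linear mon0 Y -> fgprod _ _}) (mon_map Y y).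
  by rewrite /= /mon_twist_map /lpair /t /= (rE y) linearD !mhomE.
exists (mon_twist tP), (@MonHom Y (mon_twist tP) _ _ gE), (mon_twist_in tP).
exists (mon_twist_out tP); split; first exact: mon_twist_conflation.
  apply: mhom_ext => x; rewrite /= /lpair /= ?ri1 ?ri0; congr (_, _);
  by [apply: (ses_zero _ c1) | apply: (ses_zero _ c0)].
exact: mhom_ext.
Qed.

Lemma mon_inflation_pushout (X Y X' : mon_cat) (i : hom X Y) (g : hom X X') :
  inflation mon_conflation i ->
  exists (Y' : mon_cat) (g' : hom Y Y') (i' : hom X' Y'),
    pushout i g g' i' /\ inflation mon_conflation i'.
Proof.
move=> [Z [p ip]]; have [Y' [g' [i' [p' [ip' gi pg]]]]] := mon_pushout g ip.
exists Y', g', i'; split; last by exists Z, p'.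
have [[c1 c0] [c1' c0']] := (ip, ip').
have [gi1 gi0] := (fun x => mhom1E x gi, fun x => mhom0E x gi).
have [pg1 pg0] := (fun x => mhom1E x pg, fun x => mhom0E x pg).
have epi1 := push_epi c1 c1' pg1; have epi0 := push_epi c0 c0' pg0.
split=> // T a b ab.
have [u1 [ug1 ui1]] := push_univ c1 c1' gi1 pg1 (fun x => mhom1E x ab).
have [u0 [ug0 ui0]] := push_univ c0 c0' gi0 pg0 (fun x => mhom0E x ab).
have uE y : mon_map T (u1 y) = u0 (mon_map Y' y).
  have [y1 [x1 ->]] := epi1 y.
  by rewrite !linearD ug1 ui1 /= !mhomE ug0 ui0.
exists (@MonHom Y' T _ _ uE); split; first by split; apply: mhom_ext.
move=> v [vg vi]; apply: mhom_ext => y /=.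
  have [y1 [x1 ->]] := epi1 y; rewrite !linearD /= ug1 ui1.
  by rewrite -(mhom1E y1 vg) -(mhom1E x1 vi).
have [y0 [x0 ->]] := epi0 y; rewrite !linearD /= ug0 ui0.
by rewrite -(mhom0E y0 vg) -(mhom0E x0 vi).
Qed.

Lemma mon_inflation_comp (X Y Z : mon_cat) (j : hom Y Z) (i : hom X Y) :
  inflation mon_conflation i -> inflation mon_conflation j ->
  inflation mon_conflation (j ∘ i).
Proof.
move=> [C [p [ip1 ip0]]] [D [q jq]].
have [E [g' [i' [p' [[c1 c0] gi pg]]]]] := mon_pushout p jq.
have [jq1 jq0] := jq; exists E, g'; split.
  exact: (push_ses jq1 c1 (fun x => mhom1E x gi) (fun x => mhom1E x pg) ip1).
exact: (push_ses jq0 c0 (fun x => mhom0E x gi) (fun x => mhom0E x pg) ip0).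
Qed.

Lemma mon_pullback (X Y Z Z' : mon_cat) (i : hom X Y) (p : hom Y Z)
    (g : hom Z' Z) :
  mon_conflation i p ->
  exists (Y' : mon_cat) (g' : hom Y' Y) (i' : hom X Y') (p' : hom Y' Z'),
    [/\ mon_conflation i' p', g' ∘ i' = i & p ∘ g' = g ∘ p'].
Proof.
move=> ip; have [c1 c0] := ip.
have [s1 [r1 [ps1 ri1 ir1 rs1]]] := ses_split c1.
have [s0 [r0 [ps0 ri0 ir0 rs0]]] := ses_split c0.
pose t := r0 \o mon_map Y \o s1 \o mhom1 g : {linear mon1 Z' -> mon0 X}.
have rE y : r0 (mon_map Y y) = mon_map X (r1 y) + r0 (mon_map Y (s1 (mhom1 p y))).
  rewrite -[y in LHS](subrK (s1 (mhom1 p y))) -ir1 !linearD /=.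
  by rewrite mhomE ri0.
have tP (z0 : mon0 Z') (z1 : mon1 Z') : mon_map Z' z1 = w *: z0 ->
    exists x1, mon_map X x1 = t z1.
  move=> e; have [y1 y1E] := mon_coker (s0 (mhom0 g z0)).
  have pE : mhom1 p y1 = mhom1 g z1.
    by apply: (@mon_inj Z); rewrite mhomE y1E linearZ /= ps0 mhomE e linearZ.
  exists (- r1 y1); rewrite linearN /=.
  have := rE y1; rewrite y1E linearZ /= rs0 scaler0 pE => /esym/eqP.
  by rewrite addrC addr_eq0 => /eqP ->.
have gE (y : mon1 (mon_twist tP)) : mon_map Y
    (((mhom1 i \o fst) \+ (s1 \o mhom1 g \o snd)
      : {linear fgprod (mon1 X) (mon1 Z') -> mon1 Y}) y)
    = ((mhom0 i \o fst) \+ (s0 \o mhom0 g \o snd)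
      : {linear fgprod (mon0 X) (mon0 Z') -> mon0 Y}) (mon_map (mon_twist tP) y).
  rewrite /= /mon_twist_map /lpair /t /= !linearD /= -!mhomE -addrA.
  congr (_ + _); rewrite ir0 -mhomE ps1.
  by rewrite subrK.
exists (mon_twist tP), (@MonHom (mon_twist tP) Y _ _ gE), (mon_twist_in tP).
exists (mon_twist_out tP); split; first exact: mon_twist_conflation.
  by apply: mhom_ext => x; rewrite /= /lpair /= !linear0 addr0.
apply: mhom_ext => -[x z] /=; rewrite linearD ?ps1 ?ps0.
  by rewrite (ses_zero _ c1) add0r.
by rewrite (ses_zero _ c0) add0r.
Qed.

Lemma mon_deflation_pullback (Y Z Z' : mon_cat) (p : hom Y Z) (g : hom Z' Z) :
  deflation mon_conflation p ->
  exists (Y' : mon_cat) (g' : hom Y' Y) (p' : hom Y' Z'),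
    pullback p g g' p' /\ deflation mon_conflation p'.
Proof.
move=> [X [i ip]]; have [Y' [g' [i' [p' [ip' gi pg]]]]] := mon_pullback g ip.
exists Y', g', p'; split; last by exists X, i'.
have [[c1 c0] [c1' c0']] := (ip, ip').
have [gi1 gi0] := (fun x => mhom1E x gi, fun x => mhom0E x gi).
have [pg1 pg0] := (fun x => mhom1E x pg, fun x => mhom0E x pg).
have mono1 := pull_mono c1 c1' gi1; have mono0 := pull_mono c0 c0' gi0.
split=> // T a b ab.
have [u1 [ug1 up1]] := pull_univ c1 c1' gi1 pg1 (fun x => mhom1E x ab).
have [u0 [ug0 up0]] := pull_univ c0 c0' gi0 pg0 (fun x => mhom0E x ab).
have uE y : mon_map Y' (u1 y) = u0 (mon_map T y).
  by apply: mono0; rewrite ?ug0 ?up0 -!mhomE ?ug1 ?up1.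
exists (@MonHom T Y' _ _ uE); split; first by split; apply: mhom_ext.
move=> v [vg vp]; apply: mhom_ext => y /=.
  by apply: mono1; rewrite ?ug1 ?up1 -?(mhom1E y vg) -?(mhom1E y vp).
by apply: mono0; rewrite ?ug0 ?up0 -?(mhom0E y vg) -?(mhom0E y vp).
Qed.

Lemma mon_deflation_comp (X Y Z : mon_cat) (q : hom Y Z) (p : hom X Y) :
  deflation mon_conflation p -> deflation mon_conflation q ->
  deflation mon_conflation (q ∘ p).
Proof.
move=> [A [i ip]] [K [k [kq1 kq0]]].
have [E [g' [i' [p' [[c1 c0] gi pg]]]]] := mon_pullback k ip.
have [ip1 ip0] := ip; exists E, g'; split.
  exact: (pull_ses ip1 c1 (fun x => mhom1E x gi) (fun x => mhom1E x pg) kq1).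
exact: (pull_ses ip0 c0 (fun x => mhom0E x gi) (fun x => mhom0E x pg) kq0).
Qed.

Lemma mon_exact : exact_structure mon_conflation.
Proof.
split.
- exact: mon_conflation_kernel.
- exact: mon_conflation_cokernel.
- exact: mon_conflation_iso.
- exact: mon_inflation_id.
- exact: mon_deflation_id.
- exact: mon_inflation_comp.
- exact: mon_deflation_comp.
- exact: mon_inflation_pushout.
- exact: mon_deflation_pullback.
Qed.

Section Frobenius.
Hypothesis w_reg : GRing.lreg w.

Lemma mon_invP (X : mon_cat) :
  {e : {linear mon0 X -> mon1 X} | forall y, mon_map X (e y) = w *: y}.
Proof.
apply: (@inj_lift _ _ _ _ _ (w \*: idfun : {linear mon0 X -> mon0 X})).
  exact: mon_inj.
exact: mon_coker.
Qed.

Definition mon_inv X : {linear mon0 X -> mon1 X} := projT1 (mon_invP X).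

Lemma mon_invK (X : mon_cat) y : mon_map X (mon_inv X y) = w *: y.
Proof. by rewrite /mon_inv; case: mon_invP. Qed.

Lemma mon_invKV (X : mon_cat) x : mon_inv X (mon_map X x) = w *: x.
Proof. by apply: (@mon_inj X); rewrite mon_invK linearZ. Qed.

Lemma mon_swap_inj (X : mon_cat) : injective (mon_inv X).
Proof.
by move=> x y e; apply: (lreg_fgproj w_reg); rewrite /= -!mon_invK e.
Qed.

Lemma mon_swap_coker (X : mon_cat) (y : mon1 X) : exists x, mon_inv X x = w *: y.
Proof. by exists (mon_map X y); rewrite mon_invKV. Qed.

Definition mon_swap X := MonObj (@mon_swap_inj X) (@mon_swap_coker X).

(* The direct sum of the identity of P and of the multiplication by w on Q. *)
Section Cone.
Variables P Q : fgproj S.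

Definition mon_cone_map : {linear fgprod P Q -> fgprod P Q} :=
  lpair fst (w \*: (snd : {linear fgprod P Q -> Q})).

Lemma mon_cone_inj : injective mon_cone_map.
Proof.
by move=> [a b] [a' b'] [/= -> /(lreg_fgproj w_reg) ->].
Qed.

Lemma mon_cone_coker y : exists x, mon_cone_map x = w *: y.
Proof. by case: y => a b; exists (w *: a, b). Qed.

Definition mon_cone := MonObj mon_cone_inj mon_cone_coker.

Lemma mon_cone_projective : projective_object mon_conflation mon_cone.
Proof.
move=> Y Z q f [X [i [c1 c0]]].
have [a aE] := fgproj_proj
  (mhom1 f \o (lpair idfun \0 : {linear P -> fgprod P Q}) : {linear P -> mon1 Z})
  (ses_surj c1).
have [b bE] := fgproj_proj
  (mhom0 f \o (lpair \0 idfun : {linear Q -> fgprod P Q}) : {linear Q -> mon0 Z})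
  (ses_surj c0).
pose h1 := (a \o fst) \+ (mon_inv Y \o b \o snd) : {linear fgprod P Q -> mon1 Y}.
pose h0 := (mon_map Y \o a \o fst) \+ (b \o snd) : {linear fgprod P Q -> mon0 Y}.
have hE x : mon_map Y (h1 x) = h0 (mon_map mon_cone x).
  by rewrite /h1 /h0 /= linearD mon_invK linearZ.
have h0E x : mhom0 q (h0 x) = mhom0 f x.
  case: x => x y; rewrite /h0 /= linearD -mhomE aE bE /=.
  have -> : mon_map Z (mhom1 f (lpair idfun \0 x)) = mhom0 f (x, w *: 0).
    exact: (mhomE f (x, 0)).
  rewrite -(linearD (mhom0 f)); congr (mhom0 f _).
  by congr (_, _); rewrite /= ?scaler0 ?addr0 ?add0r.
exists (@MonHom mon_cone Y _ _ hE); apply: mhom_ext => x /=; last exact: h0E.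
by apply: (@mon_inj Z); rewrite !mhomE -h0E hE.
Qed.

Lemma mon_cone_injective : injective_object mon_conflation mon_cone.
Proof.
move=> X Y i f [Z [p [c1 c0]]].
have [s1 [r1 [_ ri1 _ _]]] := ses_split c1.
have [s0 [r0 [_ ri0 _ _]]] := ses_split c0.
pose b := (fst : {linear fgprod P Q -> P}) \o mhom0 f \o r0 : {linear mon0 Y -> P}.
pose a := (snd : {linear fgprod P Q -> Q}) \o mhom1 f \o r1 : {linear mon1 Y -> Q}.
pose h1 := lpair (b \o mon_map Y) a : {linear mon1 Y -> fgprod P Q}.
pose h0 := lpair b (a \o mon_inv Y) : {linear mon0 Y -> fgprod P Q}.
have hE x : mon_map mon_cone (h1 x) = h0 (mon_map Y x).
  by rewrite /= /mon_cone_map /h1 /h0 /lpair /= mon_invKV !linearZZ.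
have h1E x : h1 (mhom1 i x) = mhom1 f x.
  transitivity ((mhom0 f (r0 (mon_map Y (mhom1 i x)))).1, (mhom1 f (r1 (mhom1 i x))).2).
    by [].
  by rewrite ri1 mhomE ri0 -mhomE /=; case: (mhom1 f x).
exists (@MonHom Y mon_cone _ _ hE); apply: mhom_ext => x /=; first exact: h1E.
apply: (@lreg_fgproj S w (fgprod P Q) w_reg).
rewrite -[LHS](linearZZ h0) -[RHS](linearZZ (mhom0 f)) -(linearZZ (mhom0 i)).
by rewrite -mon_invK -!mhomE -hE h1E.
Qed.

End Cone.

Lemma mon_emb (X : mon_cat) : exists (i : @hom mon_cat X (mon_cone (mon0 X) (mon1 X)))
    (p : @hom mon_cat (mon_cone (mon0 X) (mon1 X)) (mon_swap X)), mon_conflation i p.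
Proof.
pose C := mon_cone (mon0 X) (mon1 X).
have iE x : mon_map C ((lpair (mon_map X) idfun : {linear mon1 X -> mon1 C}) x)
    = (lpair idfun (mon_inv X) : {linear mon0 X -> mon0 C}) (mon_map X x).
  by rewrite /= /mon_cone_map /= /lpair /= mon_invKV.
have pE (x : mon1 C) : mon_map (mon_swap X)
    ((fst \- (mon_map X \o snd) : {linear fgprod (mon0 X) (mon1 X) -> mon0 X}) x)
    = ((mon_inv X \o fst) \- snd : {linear fgprod (mon0 X) (mon1 X) -> mon1 X})
        (mon_map C x).
  by rewrite /= linearB mon_invKV.
exists (@MonHom X C _ _ iE), (@MonHom C (mon_swap X) _ _ pE); split; split=> /=.
- by move=> x y [].
- by move=> z; exists (z, 0); rewrite /= linear0 subr0.
- move=> [x y] /=; split=> [/eqP|[z [<- <-]]]; last by rewrite subrr.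
  by rewrite subr_eq0 => /eqP ->; exists y.
- by move=> x y [].
- by move=> z; exists (0, - z); rewrite /= linear0 sub0r opprK.
- move=> [x y] /=; split=> [/eqP|[z [<- <-]]]; last by rewrite subrr.
  by rewrite subr_eq0 => /eqP <-; exists x.
Qed.

Lemma mon_cover (X : mon_cat) : exists (i : @hom mon_cat (mon_swap X) (mon_cone (mon1 X) (mon0 X)))
    (p : @hom mon_cat (mon_cone (mon1 X) (mon0 X)) X), mon_conflation i p.
Proof.
pose C := mon_cone (mon1 X) (mon0 X).
have iE (x : mon0 X) :
    mon_map C ((lpair (mon_inv X) (\- idfun) : {linear mon0 X -> mon1 C}) x)
    = (lpair idfun (\- mon_map X) : {linear mon1 X -> mon0 C}) (mon_inv X x).
  by rewrite /= /mon_cone_map /= /lpair /= mon_invK scalerN.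
have pE (x : mon1 C) : mon_map X
    ((fst \+ (mon_inv X \o snd) : {linear fgprod (mon1 X) (mon0 X) -> mon1 X}) x)
    = ((mon_map X \o fst) \+ snd : {linear fgprod (mon1 X) (mon0 X) -> mon0 X})
        (mon_map C x).
  by rewrite /= linearD mon_invK.
exists (@MonHom (mon_swap X) C _ _ iE), (@MonHom C X _ _ pE); split; split=> /=.
- by move=> x y [_ /oppr_inj].
- by move=> z; exists (z, 0); rewrite /= linear0 addr0.
- move=> [x y] /=; split=> [/eqP|[z [<- <-]]]; last by rewrite linearN subrr.
  rewrite addr_eq0 -linearN => /eqP ->; exists (- y).
  by rewrite /lpair /= opprK.
- by move=> x y [].
- by move=> z; exists (0, z); rewrite /= linear0 add0r.
- move=> [x y] /=; split=> [/eqP|[z [<- <-]]]; last by rewrite subrr.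
  by rewrite addrC addr_eq0 => /eqP ->; exists x.
Qed.

Lemma mon_enough_inj : enough_injectives mon_conflation.
Proof.
move=> X; have [i [p ip]] := mon_emb X.
exact: inhabits (InjectiveEmbedding ip (@mon_cone_injective _ _)).
Qed.

Lemma mon_enough_proj : enough_projectives mon_conflation.
Proof.
move=> X; have [i [p ip]] := mon_cover X.
exists (mon_cone (mon1 X) (mon0 X)), p; split; first exact: mon_cone_projective.
by exists (mon_swap X), i.
Qed.

Lemma mon_proj_inj (X : mon_cat) :
  projective_object mon_conflation X <-> injective_object mon_conflation X.
Proof.
split=> H.
  have [i [p ip]] := mon_cover X.
  have [|s sE] := H _ _ p (idm X); first by exists (mon_swap X), i.
  exact: (@retract_injective mon_cat _ _ _ s p sE (@mon_cone_injective _ _)).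
have [i [p ip]] := mon_emb X.
have [|s sE] := H _ _ i (idm X); first by exists (mon_swap X), p.
exact: (@retract_projective mon_cat _ _ _ i s sE (@mon_cone_projective _ _)).
Qed.

Definition Mon : frobenius_category :=
  @FrobeniusCategory mon_cat mon_conflation mon_additive mon_exact
    mon_enough_inj mon_enough_proj mon_proj_inj.

End Frobenius.
End Mon.

(** * The category MF(w, P) *)

Section MF.
Variables (S : comNzRingType) (w : S).

Record mf_obj := MFObj {
  mf1 : fgproj S;
  mf0 : fgproj S;
  rho1 : {linear mf1 -> mf0};
  rho0 : {linear mf0 -> mf1};
  rho10 : forall x, rho1 (rho0 x) = w *: x;
  rho01 : forall x, rho0 (rho1 x) = w *: x }.

Record mf_hom (X Y : mf_obj) := MFHom {
  fhom1 : {linear mf1 X -> mf1 Y};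
  fhom0 : {linear mf0 X -> mf0 Y};
  fhomE : forall x, rho1 Y (fhom1 x) = fhom0 (rho1 X x);
  fhomE0 : forall x, rho0 Y (fhom0 x) = fhom1 (rho0 X x) }.

Implicit Types X Y Z T : mf_obj.

Lemma fhom_ext X Y (f g : mf_hom X Y) :
  fhom1 f =1 fhom1 g -> fhom0 f =1 fhom0 g -> f = g.
Proof.
case: f g => [f1 f0 fE fE0] [g1 g0 gE gE0] /= /linear_ext e1 /linear_ext e0.
by subst g1 g0; rewrite (Prop_irrelevance fE gE) (Prop_irrelevance fE0 gE0).
Qed.

Lemma fhom_zero_subproof1 X Y (x : mf1 X) :
  rho1 Y ((\0 : {linear mf1 X -> mf1 Y}) x)
  = (\0 : {linear mf0 X -> mf0 Y}) (rho1 X x).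
Proof. exact: linear0. Qed.

Lemma fhom_zero_subproof0 X Y (x : mf0 X) :
  rho0 Y ((\0 : {linear mf0 X -> mf0 Y}) x)
  = (\0 : {linear mf1 X -> mf1 Y}) (rho0 X x).
Proof. exact: linear0. Qed.

Definition fhom_zero X Y :=
  MFHom (@fhom_zero_subproof1 X Y) (@fhom_zero_subproof0 X Y).

Lemma fhom_opp_subproof1 X Y (f : mf_hom X Y) x :
  rho1 Y ((\- fhom1 f) x) = (\- fhom0 f) (rho1 X x).
Proof. by rewrite /= linearN fhomE. Qed.

Lemma fhom_opp_subproof0 X Y (f : mf_hom X Y) x :
  rho0 Y ((\- fhom0 f) x) = (\- fhom1 f) (rho0 X x).
Proof. by rewrite /= linearN fhomE0. Qed.

Definition fhom_opp X Y (f : mf_hom X Y) :=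
  MFHom (fhom_opp_subproof1 f) (fhom_opp_subproof0 f).

Lemma fhom_add_subproof1 X Y (f g : mf_hom X Y) x :
  rho1 Y ((fhom1 f \+ fhom1 g) x) = (fhom0 f \+ fhom0 g) (rho1 X x).
Proof. by rewrite /= linearD !fhomE. Qed.

Lemma fhom_add_subproof0 X Y (f g : mf_hom X Y) x :
  rho0 Y ((fhom0 f \+ fhom0 g) x) = (fhom1 f \+ fhom1 g) (rho0 X x).
Proof. by rewrite /= linearD !fhomE0. Qed.

Definition fhom_add X Y (f g : mf_hom X Y) :=
  MFHom (fhom_add_subproof1 f g) (fhom_add_subproof0 f g).

Lemma fhom_addA X Y : associative (@fhom_add X Y).
Proof. by move=> f g h; apply: fhom_ext => x /=; rewrite addrA. Qed.

Lemma fhom_addC X Y : commutative (@fhom_add X Y).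
Proof. by move=> f g; apply: fhom_ext => x /=; rewrite addrC. Qed.

Lemma fhom_add0 X Y : left_id (fhom_zero X Y) (@fhom_add X Y).
Proof. by move=> f; apply: fhom_ext => x /=; rewrite add0r. Qed.

Lemma fhom_addN X Y : left_inverse (fhom_zero X Y) (@fhom_opp X Y) (@fhom_add X Y).
Proof. by move=> f; apply: fhom_ext => x /=; rewrite addNr. Qed.

HB.instance Definition _ X Y := gen_eqMixin (mf_hom X Y).
HB.instance Definition _ X Y := gen_choiceMixin (mf_hom X Y).
HB.instance Definition _ X Y := GRing.isZmodule.Build (mf_hom X Y)
  (@fhom_addA X Y) (@fhom_addC X Y) (@fhom_add0 X Y) (@fhom_addN X Y).

Definition fhom_id X : mf_hom X X :=
  @MFHom X X idfun idfun (fun=> erefl) (fun=> erefl).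

Lemma fhom_comp_subproof1 X Y Z (g : mf_hom Y Z) (f : mf_hom X Y) x :
  rho1 Z ((fhom1 g \o fhom1 f) x) = (fhom0 g \o fhom0 f) (rho1 X x).
Proof. by rewrite /= !fhomE. Qed.

Lemma fhom_comp_subproof0 X Y Z (g : mf_hom Y Z) (f : mf_hom X Y) x :
  rho0 Z ((fhom0 g \o fhom0 f) x) = (fhom1 g \o fhom1 f) (rho0 X x).
Proof. by rewrite /= !fhomE0. Qed.

Definition fhom_comp X Y Z (g : mf_hom Y Z) (f : mf_hom X Y) : mf_hom X Z :=
  MFHom (fhom_comp_subproof1 g f) (fhom_comp_subproof0 g f).

Lemma fhom_comp1m X Y (f : mf_hom X Y) : fhom_comp (fhom_id Y) f = f.
Proof. exact: fhom_ext. Qed.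

Lemma fhom_compm1 X Y (f : mf_hom X Y) : fhom_comp f (fhom_id X) = f.
Proof. exact: fhom_ext. Qed.

Lemma fhom_compA X Y Z T (h : mf_hom Z T) (g : mf_hom Y Z) (f : mf_hom X Y) :
  fhom_comp h (fhom_comp g f) = fhom_comp (fhom_comp h g) f.
Proof. exact: fhom_ext. Qed.

Lemma fhom_compDl X Y Z (g g' : mf_hom Y Z) (f : mf_hom X Y) :
  fhom_comp (g + g') f = fhom_comp g f + fhom_comp g' f.
Proof. exact: fhom_ext. Qed.

Lemma fhom_compDr X Y Z (g : mf_hom Y Z) (f f' : mf_hom X Y) :
  fhom_comp g (f + f') = fhom_comp g f + fhom_comp g f'.
Proof. by apply: fhom_ext => x /=; rewrite linearD. Qed.

Definition mf_cat : preadditive :=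
  @Preadditive mf_obj mf_hom fhom_id fhom_comp
    fhom_comp1m fhom_compm1 fhom_compA fhom_compDl fhom_compDr.

Definition mf_conflation : sequence_class mf_cat := fun X Y Z i p =>
  short_exact (fhom1 i) (fhom1 p) /\ short_exact (fhom0 i) (fhom0 p).

(** ** MF(w, P) is a Frobenius category *)


Lemma fhom1E (X Y : mf_cat) (f g : mf_hom X Y) x : f = g -> fhom1 f x = fhom1 g x.
Proof. by move->. Qed.

Lemma fhom0E (X Y : mf_cat) (f g : mf_hom X Y) x : f = g -> fhom0 f x = fhom0 g x.
Proof. by move->. Qed.

Lemma mf_exact_zero (X Y Z : mf_cat) (i : hom X Y) (p : hom Y Z) :
  mf_conflation i p -> p ∘ i = 0.
Proof. by move=> [c1 c0]; apply: fhom_ext => x; apply: ses_zero. Qed.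

Lemma mf_conflation_kernel (X Y Z : mf_cat) (i : hom X Y) (p : hom Y Z) :
  mf_conflation i p -> kernel_of i p.
Proof.
move=> ip; have [c1 c0] := ip; split=> [|T t pt]; first exact: mf_exact_zero.
have [u1 u1E] := ses_kernel c1 (fun x => fhom1E x pt).
have [u0 u0E] := ses_kernel c0 (fun x => fhom0E x pt).
have uE x : rho1 X (u1 x) = u0 (rho1 T x).
  by apply: (ses_inj c0); rewrite u0E -!fhomE u1E.
have uE0 x : rho0 X (u0 x) = u1 (rho0 T x).
  by apply: (ses_inj c1); rewrite u1E -!fhomE0 u0E.
exists (MFHom uE uE0); split=> [|v vE]; first exact: fhom_ext.
apply: fhom_ext => x /=.
  by apply: (ses_inj c1); rewrite u1E -(fhom1E x vE).
by apply: (ses_inj c0); rewrite u0E -(fhom0E x vE).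
Qed.

Lemma mf_conflation_cokernel (X Y Z : mf_cat) (i : hom X Y) (p : hom Y Z) :
  mf_conflation i p -> cokernel_of i p.
Proof.
move=> ip; have [c1 c0] := ip; split=> [|T t ti]; first exact: mf_exact_zero.
have [u1 u1E] := ses_cokernel c1 (fun x => fhom1E x ti).
have [u0 u0E] := ses_cokernel c0 (fun x => fhom0E x ti).
have uE x : rho1 T (u1 x) = u0 (rho1 Z x).
  by have [y <-] := ses_surj c1 x; rewrite fhomE u1E u0E fhomE.
have uE0 x : rho0 T (u0 x) = u1 (rho0 Z x).
  by have [y <-] := ses_surj c0 x; rewrite fhomE0 u1E u0E fhomE0.
exists (MFHom uE uE0); split=> [|v vE]; first exact: fhom_ext.
apply: fhom_ext => x /=.
  by have [y <-] := ses_surj c1 x; rewrite u1E -(fhom1E y vE).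
by have [y <-] := ses_surj c0 x; rewrite u0E -(fhom0E y vE).
Qed.

Lemma mf_iso_bij (X Y : mf_cat) (f : hom X Y) :
  is_iso f -> bijective (fhom1 f) /\ bijective (fhom0 f).
Proof.
move=> [g [e1 e2]]; split; [exists (fhom1 g) | exists (fhom0 g)] => x.
- exact: (fhom1E x e1).
- exact: (fhom1E x e2).
- exact: (fhom0E x e1).
- exact: (fhom0E x e2).
Qed.

Lemma mf_conflation_iso (X Y Z X' Y' Z' : mf_cat)
    (i : hom X Y) (p : hom Y Z)
    (i' : hom X' Y') (p' : hom Y' Z')
    (a : hom X X') (b : hom Y Y') (c : hom Z Z') :
  is_iso a -> is_iso b -> is_iso c -> b ∘ i = i' ∘ a -> c ∘ p = p' ∘ b ->
  mf_conflation i p -> mf_conflation i' p'.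
Proof.
move=> /mf_iso_bij[a1 a0] /mf_iso_bij[b1 b0] /mf_iso_bij[c1 c0] e1 e2 [ip1 ip0].
split.
  exact: (ses_iso a1 b1 c1 (fun x => fhom1E x e1) (fun x => fhom1E x e2)).
exact: (ses_iso a0 b0 c0 (fun x => fhom0E x e1) (fun x => fhom0E x e2)).
Qed.

Lemma mf_zero_subproof (x : fgzero S) :
  (\0 : {linear fgzero S -> fgzero S}) ((\0 : {linear fgzero S -> fgzero S}) x)
  = w *: x.
Proof. by rewrite [LHS]fgzero_eq0 [RHS]fgzero_eq0. Qed.

Definition mf_zero := MFObj mf_zero_subproof mf_zero_subproof.

Lemma mf_inflation_id (X : mf_cat) : inflation mf_conflation (idm X).
Proof. by exists mf_zero, (0 : mf_hom X mf_zero); split; exact: ses_idl. Qed.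

Lemma mf_deflation_id (X : mf_cat) : deflation mf_conflation (idm X).
Proof. by exists mf_zero, (0 : mf_hom mf_zero X); split; exact: ses_idr. Qed.

(* The extension of Z by X whose structure maps are upper triangular, with
   off-diagonal entries t1 and t0. *)
Section Twist.
Variables (X Z : mf_obj).
Variables (t1 : {linear mf1 Z -> mf0 X}) (t0 : {linear mf0 Z -> mf1 X}).
Hypothesis tP1 : forall z, rho1 X (t0 z) + t1 (rho0 Z z) = 0.
Hypothesis tP0 : forall z, rho0 X (t1 z) + t0 (rho1 Z z) = 0.

Definition mf_twist_rho1 : {linear fgprod (mf1 X) (mf1 Z) -> fgprod (mf0 X) (mf0 Z)} :=
  lpair ((rho1 X \o fst) \+ (t1 \o snd)) (rho1 Z \o snd).

Definition mf_twist_rho0 : {linear fgprod (mf0 X) (mf0 Z) -> fgprod (mf1 X) (mf1 Z)} :=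
  lpair ((rho0 X \o fst) \+ (t0 \o snd)) (rho0 Z \o snd).

Lemma mf_twist_rho10 x : mf_twist_rho1 (mf_twist_rho0 x) = w *: x.
Proof.
case: x => x z; rewrite /mf_twist_rho1 /mf_twist_rho0 /= /lpair /=.
by rewrite linearD -addrA tP1 !rho10 addr0.
Qed.

Lemma mf_twist_rho01 x : mf_twist_rho0 (mf_twist_rho1 x) = w *: x.
Proof.
case: x => x z; rewrite /mf_twist_rho1 /mf_twist_rho0 /= /lpair /=.
by rewrite linearD -addrA tP0 !rho01 addr0.
Qed.

Definition mf_twist := MFObj mf_twist_rho10 mf_twist_rho01.

Lemma mf_twist_in_subproof1 x :
  rho1 mf_twist ((lpair idfun \0 : {linear mf1 X -> mf1 mf_twist}) x)
  = (lpair idfun \0 : {linear mf0 X -> mf0 mf_twist}) (rho1 X x).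
Proof. by rewrite /= /mf_twist_rho1 /= /lpair /= !linear0 addr0. Qed.

Lemma mf_twist_in_subproof0 x :
  rho0 mf_twist ((lpair idfun \0 : {linear mf0 X -> mf0 mf_twist}) x)
  = (lpair idfun \0 : {linear mf1 X -> mf1 mf_twist}) (rho0 X x).
Proof. by rewrite /= /mf_twist_rho0 /= /lpair /= !linear0 addr0. Qed.

Definition mf_twist_in := MFHom mf_twist_in_subproof1 mf_twist_in_subproof0.

Definition mf_twist_out : mf_hom mf_twist Z :=
  @MFHom mf_twist Z snd snd (fun=> erefl) (fun=> erefl).

Lemma mf_twist_conflation : mf_conflation mf_twist_in mf_twist_out.
Proof. by split; exact: ses_prod. Qed.

End Twist.

Lemma mf_additive : additive_category mf_cat.
Proof.
split.
  by exists mf_zero; apply: fhom_ext => x; rewrite [LHS]fgzero_eq0 [RHS]fgzero_eq0.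
move=> X Y; pose t1 : {linear mf1 Y -> mf0 X} := \0.
pose t0 : {linear mf0 Y -> mf1 X} := \0.
have tP1 (y : mf0 Y) : rho1 X (t0 y) + t1 (rho0 Y y) = 0.
  by rewrite linear0 addr0.
have tP0 (y : mf1 Y) : rho0 X (t1 y) + t0 (rho1 Y y) = 0.
  by rewrite linear0 addr0.
have i2E1 x : rho1 (mf_twist tP1 tP0) ((lpair \0 idfun : {linear mf1 Y -> fgprod _ _}) x)
    = (lpair \0 idfun : {linear mf0 Y -> fgprod _ _}) (rho1 Y x).
  by rewrite /= /mf_twist_rho1 /= /lpair /= linear0 addr0.
have i2E0 x : rho0 (mf_twist tP1 tP0) ((lpair \0 idfun : {linear mf0 Y -> fgprod _ _}) x)
    = (lpair \0 idfun : {linear mf1 Y -> fgprod _ _}) (rho0 Y x).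
  by rewrite /= /mf_twist_rho0 /= /lpair /= linear0 addr0.
have p1E1 (x : mf1 (mf_twist tP1 tP0)) :
    rho1 X (fst x) = fst (rho1 (mf_twist tP1 tP0) x).
  by rewrite /= /mf_twist_rho1 /= /lpair /= addr0.
have p1E0 (x : mf0 (mf_twist tP1 tP0)) :
    rho0 X (fst x) = fst (rho0 (mf_twist tP1 tP0) x).
  by rewrite /= /mf_twist_rho0 /= /lpair /= addr0.
exists (mf_twist tP1 tP0), (mf_twist_in tP1 tP0), (@MFHom Y (mf_twist tP1 tP0) _ _ i2E1 i2E0).
exists (@MFHom (mf_twist tP1 tP0) X fst fst p1E1 p1E0), (mf_twist_out tP1 tP0).
by split; apply: fhom_ext => // -[x y]; rewrite /= /lpair /=;
  congr (_, _); rewrite /= ?addr0 ?add0r.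
Qed.

(* The off-diagonal entries of a conflation with chosen componentwise splittings. *)
Section Split.
Variables (X Y Z : mf_obj) (i : mf_hom X Y) (p : mf_hom Y Z).
Variables (s1 : {linear mf1 Z -> mf1 Y}) (r1 : {linear mf1 Y -> mf1 X}).
Variables (s0 : {linear mf0 Z -> mf0 Y}) (r0 : {linear mf0 Y -> mf0 X}).
Hypotheses (ps1 : forall z, fhom1 p (s1 z) = z) (ps0 : forall z, fhom0 p (s0 z) = z).
Hypotheses (ri1 : forall x, r1 (fhom1 i x) = x) (ri0 : forall x, r0 (fhom0 i x) = x).
Hypotheses (ir1 : forall y, fhom1 i (r1 y) = y - s1 (fhom1 p y)).
Hypotheses (ir0 : forall y, fhom0 i (r0 y) = y - s0 (fhom0 p y)).
Hypotheses (rs1 : forall z, r1 (s1 z) = 0) (rs0 : forall z, r0 (s0 z) = 0).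

Lemma mf_split_r1 y :
  r0 (rho1 Y y) = rho1 X (r1 y) + r0 (rho1 Y (s1 (fhom1 p y))).
Proof.
rewrite -[y in LHS](subrK (s1 (fhom1 p y))) -ir1 !linearD /=.
by rewrite fhomE ri0.
Qed.

Lemma mf_split_r0 y :
  r1 (rho0 Y y) = rho0 X (r0 y) + r1 (rho0 Y (s0 (fhom0 p y))).
Proof.
rewrite -[y in LHS](subrK (s0 (fhom0 p y))) -ir0 !linearD /=.
by rewrite fhomE0 ri1.
Qed.

Lemma mf_split_t1 z :
  rho1 X (r1 (rho0 Y (s0 z))) + r0 (rho1 Y (s1 (rho0 Z z))) = 0.
Proof.
have := mf_split_r1 (rho0 Y (s0 z)).
by rewrite rho10 linearZ /= rs0 scaler0 -fhomE0 ps0 => <-.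
Qed.

Lemma mf_split_t0 z :
  rho0 X (r0 (rho1 Y (s1 z))) + r1 (rho0 Y (s0 (rho1 Z z))) = 0.
Proof.
have := mf_split_r0 (rho1 Y (s1 z)).
by rewrite rho01 linearZ /= rs1 scaler0 -fhomE ps1 => <-.
Qed.

End Split.

Lemma mf_pushout (X Y Z X' : mf_cat) (i : hom X Y) (p : hom Y Z) (g : hom X X') :
  mf_conflation i p ->
  exists (Y' : mf_cat) (g' : hom Y Y') (i' : hom X' Y') (p' : hom Y' Z),
    [/\ mf_conflation i' p', g' ∘ i = i' ∘ g & p' ∘ g' = p].
Proof.
move=> ip; have [c1 c0] := ip.
have [s1 [r1 [ps1 ri1 ir1 rs1]]] := ses_split c1.
have [s0 [r0 [ps0 ri0 ir0 rs0]]] := ses_split c0.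
have r1E := mf_split_r1 ri0 ir1; have r0E := mf_split_r0 ri1 ir0.
have t1E := mf_split_t1 ps0 ri0 ir1 rs0; have t0E := mf_split_t0 ps1 ri1 ir0 rs1.
pose t1 := fhom0 g \o r0 \o rho1 Y \o s1 : {linear mf1 Z -> mf0 X'}.
pose t0 := fhom1 g \o r1 \o rho0 Y \o s0 : {linear mf0 Z -> mf1 X'}.
have tP1 z : rho1 X' (t0 z) + t1 (rho0 Z z) = 0.
  by rewrite /t0 /t1 /= fhomE -linearD t1E linear0.
have tP0 z : rho0 X' (t1 z) + t0 (rho1 Z z) = 0.
  by rewrite /t0 /t1 /= fhomE0 -linearD t0E linear0.
have gE1 y : rho1 (mf_twist tP1 tP0)
    ((lpair (fhom1 g \o r1) (fhom1 p) : {linear mf1 Y -> fgprod _ _}) y)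
    = (lpair (fhom0 g \o r0) (fhom0 p) : {linear mf0 Y -> fgprod _ _}) (rho1 Y y).
  by rewrite /= /mf_twist_rho1 /= /lpair /t1 /= (r1E y) linearD !fhomE.
have gE0 y : rho0 (mf_twist tP1 tP0)
    ((lpair (fhom0 g \o r0) (fhom0 p) : {linear mf0 Y -> fgprod _ _}) y)
    = (lpair (fhom1 g \o r1) (fhom1 p) : {linear mf1 Y -> fgprod _ _}) (rho0 Y y).
  by rewrite /= /mf_twist_rho0 /= /lpair /t0 /= (r0E y) linearD !fhomE0.
exists (mf_twist tP1 tP0), (@MFHom Y (mf_twist tP1 tP0) _ _ gE1 gE0).
exists (mf_twist_in tP1 tP0), (mf_twist_out tP1 tP0).
split; first exact: mf_twist_conflation.
  apply: fhom_ext => x; rewrite /= /lpair /= ?ri1 ?ri0; congr (_, _);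
  by [apply: (ses_zero _ c1) | apply: (ses_zero _ c0)].
exact: fhom_ext.
Qed.

Lemma mf_inflation_pushout (X Y X' : mf_cat) (i : hom X Y) (g : hom X X') :
  inflation mf_conflation i ->
  exists (Y' : mf_cat) (g' : hom Y Y') (i' : hom X' Y'),
    pushout i g g' i' /\ inflation mf_conflation i'.
Proof.
move=> [Z [p ip]]; have [Y' [g' [i' [p' [ip' gi pg]]]]] := mf_pushout g ip.
exists Y', g', i'; split; last by exists Z, p'.
have [[c1 c0] [c1' c0']] := (ip, ip').
have [gi1 gi0] := (fun x => fhom1E x gi, fun x => fhom0E x gi).
have [pg1 pg0] := (fun x => fhom1E x pg, fun x => fhom0E x pg).
have epi1 := push_epi c1 c1' pg1; have epi0 := push_epi c0 c0' pg0.
split=> // T a b ab.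
have [u1 [ug1 ui1]] := push_univ c1 c1' gi1 pg1 (fun x => fhom1E x ab).
have [u0 [ug0 ui0]] := push_univ c0 c0' gi0 pg0 (fun x => fhom0E x ab).
have uE y : rho1 T (u1 y) = u0 (rho1 Y' y).
  have [y1 [x1 ->]] := epi1 y.
  by rewrite !linearD ug1 ui1 /= !fhomE ug0 ui0.
have uE0 y : rho0 T (u0 y) = u1 (rho0 Y' y).
  have [y0 [x0 ->]] := epi0 y.
  by rewrite !linearD ug0 ui0 /= !fhomE0 ug1 ui1.
exists (@MFHom Y' T _ _ uE uE0); split; first by split; apply: fhom_ext.
move=> v [vg vi]; apply: fhom_ext => y /=.
  have [y1 [x1 ->]] := epi1 y; rewrite !linearD /= ug1 ui1.
  by rewrite -(fhom1E y1 vg) -(fhom1E x1 vi).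
have [y0 [x0 ->]] := epi0 y; rewrite !linearD /= ug0 ui0.
by rewrite -(fhom0E y0 vg) -(fhom0E x0 vi).
Qed.

Lemma mf_inflation_comp (X Y Z : mf_cat) (j : hom Y Z) (i : hom X Y) :
  inflation mf_conflation i -> inflation mf_conflation j ->
  inflation mf_conflation (j ∘ i).
Proof.
move=> [C [p [ip1 ip0]]] [D [q jq]].
have [E [g' [i' [p' [[c1 c0] gi pg]]]]] := mf_pushout p jq.
have [jq1 jq0] := jq; exists E, g'; split.
  exact: (push_ses jq1 c1 (fun x => fhom1E x gi) (fun x => fhom1E x pg) ip1).
exact: (push_ses jq0 c0 (fun x => fhom0E x gi) (fun x => fhom0E x pg) ip0).
Qed.

Lemma mf_pullback (X Y Z Z' : mf_cat) (i : hom X Y) (p : hom Y Z) (g : hom Z' Z) :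
  mf_conflation i p ->
  exists (Y' : mf_cat) (g' : hom Y' Y) (i' : hom X Y') (p' : hom Y' Z'),
    [/\ mf_conflation i' p', g' ∘ i' = i & p ∘ g' = g ∘ p'].
Proof.
move=> ip; have [c1 c0] := ip.
have [s1 [r1 [ps1 ri1 ir1 rs1]]] := ses_split c1.
have [s0 [r0 [ps0 ri0 ir0 rs0]]] := ses_split c0.
have t1E := mf_split_t1 ps0 ri0 ir1 rs0; have t0E := mf_split_t0 ps1 ri1 ir0 rs1.
pose t1 := r0 \o rho1 Y \o s1 \o fhom1 g : {linear mf1 Z' -> mf0 X}.
pose t0 := r1 \o rho0 Y \o s0 \o fhom0 g : {linear mf0 Z' -> mf1 X}.
have tP1 z : rho1 X (t0 z) + t1 (rho0 Z' z) = 0.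
  by rewrite /t0 /t1 /= -fhomE0 t1E.
have tP0 z : rho0 X (t1 z) + t0 (rho1 Z' z) = 0.
  by rewrite /t0 /t1 /= -fhomE t0E.
pose g1 := (fhom1 i \o fst) \+ (s1 \o fhom1 g \o snd)
  : {linear fgprod (mf1 X) (mf1 Z') -> mf1 Y}.
pose g0 := (fhom0 i \o fst) \+ (s0 \o fhom0 g \o snd)
  : {linear fgprod (mf0 X) (mf0 Z') -> mf0 Y}.
have gE1 y : rho1 Y (g1 y) = g0 (rho1 (mf_twist tP1 tP0) y).
  rewrite /= /mf_twist_rho1 /= /lpair /t1 /= !linearD /= -!fhomE -addrA.
  by congr (_ + _); rewrite ir0 -fhomE ps1 subrK.
have gE0 y : rho0 Y (g0 y) = g1 (rho0 (mf_twist tP1 tP0) y).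
  rewrite /= /mf_twist_rho0 /= /lpair /t0 /= !linearD /= -!fhomE0 -addrA.
  by congr (_ + _); rewrite ir1 -fhomE0 ps0 subrK.
exists (mf_twist tP1 tP0), (@MFHom (mf_twist tP1 tP0) Y _ _ gE1 gE0).
exists (mf_twist_in tP1 tP0), (mf_twist_out tP1 tP0).
split; first exact: mf_twist_conflation.
  by apply: fhom_ext => x; rewrite /= /lpair /= !linear0 addr0.
apply: fhom_ext => -[x z] /=; rewrite linearD ?ps1 ?ps0.
  by rewrite (ses_zero _ c1) add0r.
by rewrite (ses_zero _ c0) add0r.
Qed.

Lemma mf_deflation_pullback (Y Z Z' : mf_cat) (p : hom Y Z) (g : hom Z' Z) :
  deflation mf_conflation p ->
  exists (Y' : mf_cat) (g' : hom Y' Y) (p' : hom Y' Z'),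
    pullback p g g' p' /\ deflation mf_conflation p'.
Proof.
move=> [X [i ip]]; have [Y' [g' [i' [p' [ip' gi pg]]]]] := mf_pullback g ip.
exists Y', g', p'; split; last by exists X, i'.
have [[c1 c0] [c1' c0']] := (ip, ip').
have [gi1 gi0] := (fun x => fhom1E x gi, fun x => fhom0E x gi).
have [pg1 pg0] := (fun x => fhom1E x pg, fun x => fhom0E x pg).
have mono1 := pull_mono c1 c1' gi1; have mono0 := pull_mono c0 c0' gi0.
split=> // T a b ab.
have [u1 [ug1 up1]] := pull_univ c1 c1' gi1 pg1 (fun x => fhom1E x ab).
have [u0 [ug0 up0]] := pull_univ c0 c0' gi0 pg0 (fun x => fhom0E x ab).
have uE y : rho1 Y' (u1 y) = u0 (rho1 T y).
  by apply: mono0; rewrite ?ug0 ?up0 -!fhomE ?ug1 ?up1.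
have uE0 y : rho0 Y' (u0 y) = u1 (rho0 T y).
  by apply: mono1; rewrite ?ug1 ?up1 -!fhomE0 ?ug0 ?up0.
exists (@MFHom T Y' _ _ uE uE0); split; first by split; apply: fhom_ext.
move=> v [vg vp]; apply: fhom_ext => y /=.
  by apply: mono1; rewrite ?ug1 ?up1 -?(fhom1E y vg) -?(fhom1E y vp).
by apply: mono0; rewrite ?ug0 ?up0 -?(fhom0E y vg) -?(fhom0E y vp).
Qed.

Lemma mf_deflation_comp (X Y Z : mf_cat) (q : hom Y Z) (p : hom X Y) :
  deflation mf_conflation p -> deflation mf_conflation q ->
  deflation mf_conflation (q ∘ p).
Proof.
move=> [A [i ip]] [K [k [kq1 kq0]]].
have [E [g' [i' [p' [[c1 c0] gi pg]]]]] := mf_pullback k ip.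
have [ip1 ip0] := ip; exists E, g'; split.
  exact: (pull_ses ip1 c1 (fun x => fhom1E x gi) (fun x => fhom1E x pg) kq1).
exact: (pull_ses ip0 c0 (fun x => fhom0E x gi) (fun x => fhom0E x pg) kq0).
Qed.

Lemma mf_exact : exact_structure mf_conflation.
Proof.
split.
- exact: mf_conflation_kernel.
- exact: mf_conflation_cokernel.
- exact: mf_conflation_iso.
- exact: mf_inflation_id.
- exact: mf_deflation_id.
- exact: mf_inflation_comp.
- exact: mf_deflation_comp.
- exact: mf_inflation_pushout.
- exact: mf_deflation_pullback.
Qed.

Definition mf_swap (X : mf_obj) : mf_obj := MFObj (@rho01 X) (@rho10 X).

(* The direct sum of the trivial factorizations (1, w) of P and (w, 1) of Q. *)
Section Cone.
Variables P Q : fgproj S.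

Definition mf_cone_rho1 : {linear fgprod P Q -> fgprod P Q} :=
  lpair fst (w \*: (snd : {linear fgprod P Q -> Q})).

Definition mf_cone_rho0 : {linear fgprod P Q -> fgprod P Q} :=
  lpair (w \*: (fst : {linear fgprod P Q -> P})) snd.

Lemma mf_cone_rho10 x : mf_cone_rho1 (mf_cone_rho0 x) = w *: x.
Proof. by case: x. Qed.

Lemma mf_cone_rho01 x : mf_cone_rho0 (mf_cone_rho1 x) = w *: x.
Proof. by case: x. Qed.

Definition mf_cone := MFObj mf_cone_rho10 mf_cone_rho01.

Lemma mf_cone_projective : projective_object mf_conflation mf_cone.
Proof.
move=> Y Z q f [X [i [c1 c0]]].
have [a aE] := fgproj_proj
  (fhom1 f \o (lpair idfun \0 : {linear P -> fgprod P Q}) : {linear P -> mf1 Z})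
  (ses_surj c1).
have [b bE] := fgproj_proj
  (fhom0 f \o (lpair \0 idfun : {linear Q -> fgprod P Q}) : {linear Q -> mf0 Z})
  (ses_surj c0).
pose h1 := (a \o fst) \+ (rho0 Y \o b \o snd) : {linear fgprod P Q -> mf1 Y}.
pose h0 := (rho1 Y \o a \o fst) \+ (b \o snd) : {linear fgprod P Q -> mf0 Y}.
have hE1 x : rho1 Y (h1 x) = h0 (rho1 mf_cone x).
  by rewrite /h1 /h0 /= linearD rho10 linearZ.
have hE0 x : rho0 Y (h0 x) = h1 (rho0 mf_cone x).
  by rewrite /h1 /h0 /= linearD rho01 linearZ.
exists (@MFHom mf_cone Y _ _ hE1 hE0); apply: fhom_ext => -[x y] /=.
  rewrite /h1 /= linearD -fhomE0 aE bE /=.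
  have -> : rho0 Z (fhom0 f (lpair \0 idfun y)) = fhom1 f (w *: 0, y).
    exact: (fhomE0 f (0, y)).
  rewrite -(linearD (fhom1 f)); congr (fhom1 f _).
  by congr (_, _); rewrite /= ?scaler0 ?addr0 ?add0r.
rewrite /h0 /= linearD -fhomE aE bE /=.
have -> : rho1 Z (fhom1 f (lpair idfun \0 x)) = fhom0 f (x, w *: 0).
  exact: (fhomE f (x, 0)).
rewrite -(linearD (fhom0 f)); congr (fhom0 f _).
by congr (_, _); rewrite /= ?scaler0 ?addr0 ?add0r.
Qed.

Lemma mf_cone_injective : injective_object mf_conflation mf_cone.
Proof.
move=> X Y i f [Z [p [c1 c0]]].
have [s1 [r1 [_ ri1 _ _]]] := ses_split c1.
have [s0 [r0 [_ ri0 _ _]]] := ses_split c0.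
pose b := (fst : {linear fgprod P Q -> P}) \o fhom0 f \o r0 : {linear mf0 Y -> P}.
pose a := (snd : {linear fgprod P Q -> Q}) \o fhom1 f \o r1 : {linear mf1 Y -> Q}.
pose h1 := lpair (b \o rho1 Y) a : {linear mf1 Y -> fgprod P Q}.
pose h0 := lpair b (a \o rho0 Y) : {linear mf0 Y -> fgprod P Q}.
have hE1 x : rho1 mf_cone (h1 x) = h0 (rho1 Y x).
  by rewrite /= /mf_cone_rho1 /= /h1 /h0 /lpair /= rho01 !linearZZ.
have hE0 x : rho0 mf_cone (h0 x) = h1 (rho0 Y x).
  by rewrite /= /mf_cone_rho0 /= /h1 /h0 /lpair /= rho10 !linearZZ.
exists (@MFHom Y mf_cone _ _ hE1 hE0); apply: fhom_ext => x.
  transitivity ((fhom0 f (r0 (rho1 Y (fhom1 i x)))).1, (fhom1 f (r1 (fhom1 i x))).2).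
    by [].
  by rewrite ri1 fhomE ri0 -fhomE /=; case: (fhom1 f x).
transitivity ((fhom0 f (r0 (fhom0 i x))).1, (fhom1 f (r1 (rho0 Y (fhom0 i x)))).2).
  by [].
by rewrite ri0 fhomE0 ri1 -fhomE0 /=; case: (fhom0 f x).
Qed.

End Cone.

Lemma mf_emb (X : mf_cat) : exists (i : @hom mf_cat X (mf_cone (mf0 X) (mf1 X)))
    (p : @hom mf_cat (mf_cone (mf0 X) (mf1 X)) (mf_swap X)), mf_conflation i p.
Proof.
pose C := mf_cone (mf0 X) (mf1 X).
pose i1 := lpair (rho1 X) idfun : {linear mf1 X -> mf1 C}.
pose i0 := lpair idfun (rho0 X) : {linear mf0 X -> mf0 C}.
pose p1 := fst \- (rho1 X \o snd) : {linear fgprod (mf0 X) (mf1 X) -> mf0 X}.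
pose p0 := (rho0 X \o fst) \- snd : {linear fgprod (mf0 X) (mf1 X) -> mf1 X}.
have iE1 x : rho1 C (i1 x) = i0 (rho1 X x).
  by rewrite /= /mf_cone_rho1 /= /i1 /i0 /lpair /= rho01.
have iE0 x : rho0 C (i0 x) = i1 (rho0 X x).
  by rewrite /= /mf_cone_rho0 /= /i1 /i0 /lpair /= rho10.
have pE1 (x : mf1 C) : rho1 (mf_swap X) (p1 x) = p0 (rho1 C x).
  by rewrite /= linearB rho01.
have pE0 (x : mf0 C) : rho0 (mf_swap X) (p0 x) = p1 (rho0 C x).
  by rewrite /= linearB rho10.
exists (@MFHom X C _ _ iE1 iE0), (@MFHom C (mf_swap X) _ _ pE1 pE0); split; split=> /=.
- by move=> x y [].
- by move=> z; exists (z, 0); rewrite /= linear0 subr0.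
- move=> [x y] /=; split=> [/eqP|[z [<- <-]]]; last by rewrite subrr.
  by rewrite subr_eq0 => /eqP ->; exists y.
- by move=> x y [].
- by move=> z; exists (0, - z); rewrite /= linear0 sub0r opprK.
- move=> [x y] /=; split=> [/eqP|[z [<- <-]]]; last by rewrite subrr.
  by rewrite subr_eq0 => /eqP <-; exists x.
Qed.

Lemma mf_cover (X : mf_cat) : exists (i : @hom mf_cat (mf_swap X) (mf_cone (mf1 X) (mf0 X)))
    (p : @hom mf_cat (mf_cone (mf1 X) (mf0 X)) X), mf_conflation i p.
Proof.
pose C := mf_cone (mf1 X) (mf0 X).
pose i1 := lpair (rho0 X) (\- idfun) : {linear mf0 X -> mf1 C}.
pose i0 := lpair idfun (\- rho1 X) : {linear mf1 X -> mf0 C}.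
pose p1 := fst \+ (rho0 X \o snd) : {linear fgprod (mf1 X) (mf0 X) -> mf1 X}.
pose p0 := (rho1 X \o fst) \+ snd : {linear fgprod (mf1 X) (mf0 X) -> mf0 X}.
have iE1 (x : mf0 X) : rho1 C (i1 x) = i0 (rho0 X x).
  by rewrite /= /mf_cone_rho1 /= /i1 /i0 /lpair /= rho10 scalerN.
have iE0 (x : mf1 X) : rho0 C (i0 x) = i1 (rho1 X x).
  by rewrite /= /mf_cone_rho0 /= /i1 /i0 /lpair /= rho01.
have pE1 (x : mf1 C) : rho1 X (p1 x) = p0 (rho1 C x).
  by rewrite /= linearD rho10.
have pE0 (x : mf0 C) : rho0 X (p0 x) = p1 (rho0 C x).
  by rewrite /= linearD rho01.
exists (@MFHom (mf_swap X) C _ _ iE1 iE0), (@MFHom C X _ _ pE1 pE0); split; split=> /=.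
- by move=> x y [_ /oppr_inj].
- by move=> z; exists (z, 0); rewrite /= linear0 addr0.
- move=> [x y] /=; split=> [/eqP|[z [<- <-]]]; last by rewrite linearN subrr.
  rewrite addr_eq0 -linearN => /eqP ->; exists (- y).
  by rewrite /i1 /lpair /= opprK.
- by move=> x y [].
- by move=> z; exists (0, z); rewrite /= linear0 add0r.
- move=> [x y] /=; split=> [/eqP|[z [<- <-]]]; last by rewrite subrr.
  by rewrite addrC addr_eq0 => /eqP ->; exists x.
Qed.

Lemma mf_enough_inj : enough_injectives mf_conflation.
Proof.
move=> X; have [i [p ip]] := mf_emb X.
exact: inhabits (InjectiveEmbedding ip (@mf_cone_injective _ _)).
Qed.

Lemma mf_enough_proj : enough_projectives mf_conflation.
Proof.
move=> X; have [i [p ip]] := mf_cover X.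
exists (mf_cone (mf1 X) (mf0 X)), p; split; first exact: mf_cone_projective.
by exists (mf_swap X), i.
Qed.

Lemma mf_proj_inj (X : mf_cat) :
  projective_object mf_conflation X <-> injective_object mf_conflation X.
Proof.
split=> H.
  have [i [p ip]] := mf_cover X.
  have [|s sE] := H _ _ p (idm X); first by exists (mf_swap X), i.
  exact: (@retract_injective mf_cat _ _ _ s p sE (@mf_cone_injective _ _)).
have [i [p ip]] := mf_emb X.
have [|s sE] := H _ _ i (idm X); first by exists (mf_swap X), p.
exact: (@retract_projective mf_cat _ _ _ i s sE (@mf_cone_projective _ _)).
Qed.

Definition MF : frobenius_category :=
  @FrobeniusCategory mf_cat mf_conflation mf_additive mf_exact
    mf_enough_inj mf_enough_proj mf_proj_inj.

End MF.

(* Main.v *)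
From mathcomp Require Import all_boot all_algebra.
From mathcomp Require Import boolp.
Require Import Defs.

Set Implicit Arguments.
Unset Strict Implicit.
Unset Printing Implicit Defensive.

Import GRing.Theory.
Local Open Scope ring_scope.
Local Open Scope cat_scope.

(* A morphism f : P_1 -> P_0 in Mon(w, P) determines a unique g with f g = w,
   because f is injective with w Coker f = 0; conversely, since w is regular, the
   first map of a matrix factorization is injective and its cokernel is killed
   by w.  Hence f |-> (f, g) is an equivalence, in fact an isomorphism, of
   categories that preserves conflations in both directions, and such an
   equivalence of Frobenius categories induces a triangle equivalence of the
   stable categories. *)

(** * Additive functors *)

Section FunctorTheory.
Variables (C D : preadditive) (F : functor C D).

Lemma fmap_iso (X Y : C) (f : hom X Y) : is_iso f -> is_iso (fmap F f).
Proof. by case=> g [gf fg]; exists (fmap F g); rewrite -!fmapM gf fg !fmap1. Qed.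

Hypothesis addF : additive_functor F.

Lemma additive_functor0 (X Y : C) : fmap F (0 : hom X Y) = 0.
Proof. by apply: (addrI (fmap F 0)); rewrite -addF !addr0. Qed.

Lemma additive_functorN (X Y : C) (f : hom X Y) : fmap F (- f) = - fmap F f.
Proof. by apply: (addrI (fmap F f)); rewrite -addF !subrr additive_functor0. Qed.

Lemma additive_functorB (X Y : C) (f g : hom X Y) :
  fmap F (f - g) = fmap F f - fmap F g.
Proof. by rewrite addF additive_functorN. Qed.

End FunctorTheory.

(** * Exact functors and projective objects *)

Definition preserves_conflations (C D : frobenius_category) (F : functor C D) :=
  forall (X Y Z : C) (i : hom X Y) (p : hom Y Z),
    conflation i p -> conflation (fmap F i) (fmap F p).

Definition preserves_projectives (C D : frobenius_category) (F : functor C D) :=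
  forall P : C, projective_object (@conflation C) P ->
    projective_object (@conflation D) (F P).

(** [G] preserves deflations, so it turns a lifting problem for [F P] into one for [P]; [F] and the
    natural isomorphisms carry the lift back. *)
Lemma equivalence_projectives (C D : frobenius_category)
    (F : functor C D) (G : functor D C) :
  naturally_isomorphic (comp_functor G F) (id_functor C) ->
  naturally_isomorphic (comp_functor F G) (id_functor D) ->
  preserves_conflations G -> preserves_projectives F.
Proof.
move=> [eta [eta_iso etaN]] [eps [eps_iso epsN]] exG P projP Y Z q f [X [i ip]].
have [e [eeta etae]] := eta_iso P.
have [|g gE] := projP _ _ (fmap G q) (fmap G f ∘ e).
  by exists (G X), (fmap G i); exact: exG.
have [s [_ sE]] := eps_iso (F P).
(* [s] inverts [eps (F P)], and [fmap F (eta P)] cancels the [e] inserted above. *)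
exists (eps Y ∘ fmap F g ∘ fmap F (eta P) ∘ s).
have qE := epsN _ _ q; have fE := epsN _ _ f; rewrite /= in eeta sE qE fE.
rewrite !compA qE -[_ ∘ fmap F g]compA -fmapM gE -[_ ∘ fmap F (eta P)]compA.
by rewrite -fmapM -[fmap G f ∘ e ∘ _]compA eeta compm1 -fE -compA sE compm1.
Qed.

(** * Maps of conflations modulo projectives *)

Section ConflationMorphisms.
Variable C : frobenius_category.

(** Write [f = b ∘ a] through a projective, hence injective, object and extend [a] along [i] to
    [a']. Then [h - i' ∘ b ∘ a'] kills [i], so it is some [t ∘ p], and [g = p' ∘ t] factors through
    [Y']. *)
Lemma conflation_map_null (X Y Z X' Y' Z' : C)
    (i : hom X Y) (p : hom Y Z) (i' : hom X' Y') (p' : hom Y' Z')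
    (f : hom X X') (h : hom Y Y') (g : hom Z Z') :
  conflation i p -> conflation i' p' -> injective_object (@conflation C) Y' ->
  h ∘ i = i' ∘ f -> g ∘ p = p' ∘ h -> stably_null f -> stably_null g.
Proof.
move=> ip ip' injY' hE gE [Q [a [b [projQ fE]]]].
have [|a' a'E] := iffLR (frob_proj_inj Q) projQ _ _ i a; first by exists Z, p.
have [_ cokp] := conflation_cokernel (frob_exact C) ip.
have [p'i' _] := conflation_cokernel (frob_exact C) ip'.
have [|t [tE _]] := cokp _ (h - i' ∘ b ∘ a').
  by rewrite compBl hE fE -[i' ∘ b ∘ a' ∘ i]compA a'E compA subrr.
exists Y', t, p'; split; first exact/frob_proj_inj.
(* Uniqueness in the cokernel property is used to cancel [p]. *)
have [|u [_ uU]] := cokp _ (g ∘ p).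
  by rewrite -compA (conflation_cokernel (frob_exact C) ip).1 compm0.
rewrite -(uU g) // -(uU (p' ∘ t)) //.
by rewrite -compA tE compBr !compA p'i' !comp0m subr0 gE.
Qed.

Lemma conflation_map_ex (X Y Z I Z' : C)
    (i : hom X Y) (p : hom Y Z) (i' : hom X I) (p' : hom I Z') :
  conflation i p -> conflation i' p' -> injective_object (@conflation C) I ->
  exists (h : hom Y I) (k : hom Z Z'), h ∘ i = i' /\ k ∘ p = p' ∘ h.
Proof.
move=> ip ip' injI.
have [|h hE] := injI _ _ i i'; first by exists Z, p.
have [_ cokp] := conflation_cokernel (frob_exact C) ip.
have [|k [kE _]] := cokp _ (p' ∘ h); last by exists h, k.
by rewrite -compA hE (conflation_cokernel (frob_exact C) ip').1.
Qed.

(* Schanuel's lemma in the stable category. *)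
Lemma conflation_map_iso (X I Z I' Z' : C)
    (i : hom X I) (p : hom I Z) (i' : hom X I') (p' : hom I' Z')
    (h : hom I I') (k : hom Z Z') :
  conflation i p -> conflation i' p' ->
  injective_object (@conflation C) I -> injective_object (@conflation C) I' ->
  h ∘ i = i' -> k ∘ p = p' ∘ h -> @is_iso (stable_preadditive C) Z Z' (sclass k).
Proof.
move=> ip ip' injI injI' hE kE.
have [h' [k' [h'E k'E]]] := conflation_map_ex ip' ip injI.
have null0 (U V : C) : stably_null (0 : hom U V).
  by rewrite -(subrr 0); apply/sclass_eq.
exists (sclass k'); split; rewrite /= scompE; apply/sclass_eq.
  (* [k' ∘ k - 1] is induced by [h' ∘ h - 1], which lies over the zero map of [X]. *)
  apply: (conflation_map_null (h := h' ∘ h - idm I) ip ip injI _ _ (null0 X X)).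
    by rewrite compBl -compA hE h'E comp1m subrr compm0.
  by rewrite compBl compBr -compA kE !compA k'E comp1m compm1.
apply: (conflation_map_null (h := h ∘ h' - idm I') ip' ip' injI' _ _ (null0 X X)).
  by rewrite compBl -compA h'E hE comp1m subrr compm0.
by rewrite compBl compBr -compA k'E !compA kE comp1m compm1.
Qed.

End ConflationMorphisms.

(** * The triangle functor induced on stable categories *)

Section StableFunctor.
Variables (C D : frobenius_category) (F : functor C D).
Hypotheses (addF : additive_functor F) (projF : preserves_projectives F).

Lemma fmap_stably_null (X Y : C) (f : hom X Y) :
  stably_null f -> stably_null (fmap F f).
Proof.
move=> [P [a [b [projP ->]]]]; exists (F P), (fmap F a), (fmap F b).
by split; [exact: projF | exact: fmapM].
Qed.

Definition stable_fmap (X Y : C) (f : shom X Y) : shom (F X) (F Y) :=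
  sclass (fmap F (srepr f)).

(** Independence of the representative: two of them differ by a stably null map, which [F] keeps
    stably null. *)
Lemma stable_fmapE (X Y : C) (f : hom X Y) :
  stable_fmap (sclass f) = sclass (fmap F f).
Proof.
apply/sclass_eq; rewrite -additive_functorB //.
by apply/fmap_stably_null/sclass_eq; rewrite sreprK.
Qed.

Lemma stable_fmap1 (X : C) : stable_fmap (sclass (idm X)) = sclass (idm (F X)).
Proof. by rewrite stable_fmapE fmap1. Qed.

Lemma stable_fmapM (X Y Z : C) (g : shom Y Z) (f : shom X Y) :
  stable_fmap (scomp g f) = scomp (stable_fmap g) (stable_fmap f).
Proof.
have [[g0 ->] [f0 ->]] := (sclassP g, sclassP f).
by rewrite scompE !stable_fmapE scompE fmapM.
Qed.

Definition stable_functor : functor (stable C) (stable D) :=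
  @Functor (stable C) (stable D) F stable_fmap stable_fmap1 stable_fmapM.

Lemma stable_functor_additive : additive_functor stable_functor.
Proof.
move=> X Y f g /=; have [[f0 ->] [g0 ->]] := (sclassP f, sclassP g).
by rewrite -sclassD !stable_fmapE addF sclassD.
Qed.

Hypothesis exF : preserves_conflations F.

(** The image under [F] of the chosen conflation of [X] again has injective middle term. Comparing
    it with the chosen conflation of [F X] gives the shift isomorphism, by Schanuel's lemma. *)
Lemma stable_functor_triangle : triangle_functor stable_functor.
Proof.
split; first exact: stable_functor_additive.
have injF X : injective_object (@conflation D) (F (Inj X)).
  by apply/frob_proj_inj/projF/frob_proj_inj; exact: Inj_injective.
have cF X := exF (mu_pi_conflation X).
have ex X : exists k : hom (F (Sigma X)) (Sigma (F X)),
    exists h, h ∘ fmap F (mu X) = mu (F X) /\ k ∘ fmap F (pi X) = pi (F X) ∘ h.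
  have [h [k hk]] := conflation_map_ex (cF X) (mu_pi_conflation (F X))
    (@Inj_injective _ (F X)).
  by exists k, h.
pose k X := projT1 (cid (ex X)).
have kP X : exists h, h ∘ fmap F (mu X) = mu (F X)
    /\ k X ∘ fmap F (pi X) = pi (F X) ∘ h := projT2 (cid (ex X)).
pose phi (X : stable C) :
  @hom (stable D) (stable_functor (shift X)) (shift (stable_functor X)) := sclass (k X).
have phiN (X Y : stable C) (f : hom X Y) :
    fmap shift (fmap stable_functor f) ∘ phi X
    = phi Y ∘ fmap stable_functor (fmap shift f).
  rewrite /=; have [f0 ->] := sclassP f; rewrite stable_fmapE.
  have [g gP] := shift_rel_ex f0; have [g' g'P] := shift_rel_ex (fmap F f0).
  rewrite (shift_mapE gP) (shift_mapE g'P) stable_fmapE !scompE.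
  have [h [hmu gpi]] := gP; have [h' [h'mu g'pi]] := g'P.
  have [hX [hXmu kX]] := kP X; have [hY [hYmu kY]] := kP Y.
  apply/sclass_eq.
  (* Both sides of the naturality square are induced by maps of conflations over [fmap F f0]; their
     difference lies over zero. *)
  apply: (@conflation_map_null _ _ _ _ _ _ _ _ _ _ _ (fmap F f0 - fmap F f0)
    (h' ∘ hX - hY ∘ fmap F h) _ (cF X) (mu_pi_conflation (F Y))).
  - exact: Inj_injective.
  - rewrite subrr compm0 compBl -!compA hXmu h'mu -fmapM hmu fmapM compA hYmu.
    by rewrite subrr.
  - rewrite compBl compBr -!compA kX compA g'pi -fmapM gpi fmapM.
    by rewrite !compA kY.
  by apply/sclass_eq.
exists phi; split; first split=> // X.
  have [h [hmu kpi]] := kP X.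
  apply: (conflation_map_iso (cF X) (mu_pi_conflation (F X)) _ _ hmu kpi) => //.
  exact: Inj_injective.
move=> X Y Z u v w [X' [Y' [Z' [i [p [w' [a [b [c]]]]]]]]].
move=> [ip [h [hi wp]] [a_iso b_iso c_iso] [ua vb wc]].
exists (F X'), (F Y'), (F Z'), (fmap F i), (fmap F p), (k X' ∘ fmap F w').
exists (fmap stable_functor a), (fmap stable_functor b), (fmap stable_functor c).
split.
- exact: exF.
(* The image of the connecting diagram is pasted with the comparison defining [k X']. *)
- have [h' [h'mu kpi]] := kP X'; exists (h' ∘ fmap F h).
  by rewrite -!compA -!fmapM hi wp fmapM !compA kpi.
- by split; exact: fmap_iso.
rewrite -!stable_fmapE; split.
- by rewrite -[RHS](fmapM stable_functor) -ua fmapM.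
- by rewrite -[RHS](fmapM stable_functor) -vb fmapM.
(* Naturality of [phi] moves it past the shift of [a]; additivity then takes care of the sign of
   [w']. *)
rewrite -compA -[_ ∘ fmap stable_functor c]fmapM wc fmapM compA -phiN.
rewrite (additive_functorN stable_functor_additive) /= stable_fmapE.
rewrite -scompE -scompA; congr scomp; exact: (@compmN (stable D)).
Qed.

End StableFunctor.

(** * Exact equivalences induce triangle equivalences *)

Lemma stable_functor_iso_id (C D : frobenius_category)
    (F : functor C D) (G : functor D C)
    (addF : additive_functor F) (projF : preserves_projectives F)
    (addG : additive_functor G) (projG : preserves_projectives G) :
  naturally_isomorphic (comp_functor G F) (id_functor C) ->
  naturally_isomorphic
    (comp_functor (stable_functor addG projG) (stable_functor addF projF))
    (id_functor (stable C)).
Proof.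
move=> [eta [eta_iso etaN]]; exists (fun X => sclass (eta X)); split=> [X|X Y f].
  have [e [eeta etae]] := eta_iso X; exists (sclass e).
  by split; rewrite /= scompE ?eeta ?etae.
rewrite /=; have [f0 ->] := sclassP f.
by rewrite !stable_fmapE // !scompE -etaN.
Qed.

(** Exactness of each functor makes the other preserve projectives, so both functors and the two
    natural isomorphisms descend. *)
Lemma exact_equivalence_stable (C D : frobenius_category)
    (F : functor C D) (G : functor D C) :
  additive_functor F -> additive_functor G ->
  preserves_conflations F -> preserves_conflations G ->
  naturally_isomorphic (comp_functor G F) (id_functor C) ->
  naturally_isomorphic (comp_functor F G) (id_functor D) ->
  exists F' : functor (stable C) (stable D), triangle_equivalence F'.
Proof.
move=> addF addG exF exG GF FG.
have projF := equivalence_projectives GF FG exG.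
have projG := equivalence_projectives FG GF exF.
exists (stable_functor addF projF); split; first exact: stable_functor_triangle.
by exists (stable_functor addG projG); split; exact: stable_functor_iso_id.
Qed.

(** * Monomorphisms and matrix factorizations *)

Section MonMF.
Variables (S : comNzRingType) (w : S).

Definition mf_of_mon (X : mon_obj w) : mf_obj w :=
  MFObj (@mon_invK S w X) (@mon_invKV S w X).

(** The second square is automatic: under the injective [mon_map Y] both sides become
    [w *: mhom0 f y]. *)
Lemma mf_of_mon_hom_subproof (X Y : mon_obj w) (f : mon_hom X Y) y :
  mon_inv Y (mhom0 f y) = mhom1 f (mon_inv X y).
Proof. by apply: (@mon_inj _ _ Y); rewrite mhomE !mon_invK linearZ. Qed.

Definition mf_of_mon_hom (X Y : mon_obj w) (f : mon_hom X Y) :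
    mf_hom (mf_of_mon X) (mf_of_mon Y) :=
  @MFHom _ _ (mf_of_mon X) (mf_of_mon Y) _ _ (mhomE f) (mf_of_mon_hom_subproof f).

Lemma mf_of_mon1 (X : mon_obj w) : mf_of_mon_hom (mhom_id X) = fhom_id (mf_of_mon X).
Proof. exact: fhom_ext. Qed.

Lemma mf_of_monM (X Y Z : mon_obj w) (g : mon_hom Y Z) (f : mon_hom X Y) :
  mf_of_mon_hom (mhom_comp g f) = fhom_comp (mf_of_mon_hom g) (mf_of_mon_hom f).
Proof. exact: fhom_ext. Qed.

Definition mon_to_mf : functor (mon_cat w) (mf_cat w) :=
  @Functor (mon_cat w) (mf_cat w) mf_of_mon mf_of_mon_hom mf_of_mon1 mf_of_monM.

Lemma mon_to_mf_additive : additive_functor mon_to_mf.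
Proof. by move=> X Y f g; apply: fhom_ext. Qed.

Hypothesis w_reg : GRing.lreg w.

(** [rho0] after [rho1] is multiplication by the regular [w], injective on finitely generated
    projectives. *)
Lemma mf_rho1_inj (X : mf_obj w) : injective (rho1 X).
Proof. by move=> x y e; apply: (lreg_fgproj w_reg); rewrite /= -!rho01 e. Qed.

Lemma mf_rho1_coker (X : mf_obj w) y : exists x, rho1 X x = w *: y.
Proof. by exists (rho0 X y); rewrite rho10. Qed.

Definition mon_of_mf (X : mf_obj w) : mon_obj w :=
  MonObj (@mf_rho1_inj X) (@mf_rho1_coker X).

Definition mon_of_mf_hom (X Y : mf_obj w) (f : mf_hom X Y) :
    mon_hom (mon_of_mf X) (mon_of_mf Y) :=
  @MonHom _ _ (mon_of_mf X) (mon_of_mf Y) _ _ (fhomE f).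

Lemma mon_of_mf1 (X : mf_obj w) : mon_of_mf_hom (fhom_id X) = mhom_id (mon_of_mf X).
Proof. exact: mhom_ext. Qed.

Lemma mon_of_mfM (X Y Z : mf_obj w) (g : mf_hom Y Z) (f : mf_hom X Y) :
  mon_of_mf_hom (fhom_comp g f) = mhom_comp (mon_of_mf_hom g) (mon_of_mf_hom f).
Proof. exact: mhom_ext. Qed.

Definition mf_to_mon : functor (mf_cat w) (mon_cat w) :=
  @Functor (mf_cat w) (mon_cat w) mon_of_mf mon_of_mf_hom mon_of_mf1 mon_of_mfM.

Lemma mf_to_mon_additive : additive_functor mf_to_mon.
Proof. by move=> X Y f g; apply: mhom_ext. Qed.

(** The round trip changes only the proofs stored in an object, so identity maps serve as
    components. *)
Lemma mon_mf_monK :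
  naturally_isomorphic (comp_functor mf_to_mon mon_to_mf) (id_functor (mon_cat w)).
Proof.
exists (fun X => @MonHom _ _ (mon_of_mf (mf_of_mon X)) X idfun idfun (fun=> erefl)).
split=> [X|X Y f]; last exact: mhom_ext.
exists (@MonHom _ _ X (mon_of_mf (mf_of_mon X)) idfun idfun (fun=> erefl)).
by split; apply: mhom_ext.
Qed.

(** As [rho1] is injective, [rho0] is the only map whose composite with it is [w]. *)
Lemma mon_of_mf_inv (X : mf_obj w) y : mon_inv (mon_of_mf X) y = rho0 X y.
Proof. by apply: (@mf_rho1_inj X); rewrite rho10 (mon_invK (X := mon_of_mf X)). Qed.

Lemma mf_mon_mfK :
  naturally_isomorphic (comp_functor mon_to_mf mf_to_mon) (id_functor (mf_cat w)).
Proof.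
exists (fun X => @MFHom _ _ (mf_of_mon (mon_of_mf X)) X idfun idfun (fun=> erefl)
                  (fun y => esym (@mon_of_mf_inv X y))).
split=> [X|X Y f]; last exact: fhom_ext.
exists (@MFHom _ _ X (mf_of_mon (mon_of_mf X)) idfun idfun (fun=> erefl)
         (@mon_of_mf_inv X)).
by split; apply: fhom_ext.
Qed.

End MonMF.

Theorem corollary3p10 (S : comNzRingType) (n : {pred S}) (w : S) :
  noetherian S -> local_ring n -> w \in n ->
  forall w_reg : GRing.lreg w,
  exists F : functor (stable (Mon w_reg)) (stable (MF w)), triangle_equivalence F.
Proof.
move=> _ _ _ w_reg.
apply: (@exact_equivalence_stable (Mon w_reg) (MF w) (mon_to_mf w) (mf_to_mon w_reg)).
- exact: mon_to_mf_additive.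
- exact: mf_to_mon_additive.
(* Conflations on both sides are short exactness of the same linear maps. *)
- by move=> X Y Z i p.
- by move=> X Y Z i p.
- exact: mon_mf_monK.
- exact: mf_mon_mfK.
Qed.
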